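(* For every $n\in\mathbb{N}$ and $\eta\in(0,1)$, every $1$-dimensional intrinsic $1$-Lipschitz graph in $\mathbb{H}^n$ admits a corona decomposition by $1$-dimensional intrinsic $\eta$-Lipschitz graphs. That is: for every $n\in\mathbb{N}$ and $\eta\in(0,1)$ there exists a constant $C\ge1$ such that, for every $1$-dimensional horizontal subgroup $\mathbb{V}=\{(sv,0):s\in\mathbb{R}\}$ of $\mathbb{H}^n$ ($v\in\mathbb{R}^{2n}$, $|v|=1$) with complementary vertical subgroup $\mathbb{W}$, and every intrinsic $1$-Lipschitz function $\phi:\mathbb{V}\to\mathbb{W}$ with graph map $\Phi$ (write $\Phi(s):=\Phi((sv,0))$ for $s\in\mathbb{R}$), there is a coronization $\mathcal{D}=\mathcal{G}\,\dot\cup\,\mathcal{B}$ with constant $C$ and associated forest $\mathcal{F}$ with the following property. For every tree $\mathcal{T}\in\mathcal{F}$ there is an intrinsic $\eta$-Lipschitz graph $\Gamma_{\mathcal{T}}$ over some $1$-dimensional horizontal subgroup $\mathbb{V}_{\mathcal{T}}$ of $\mathbb{H}^n$ (possibly different from $\mathbb{V}$) such that $$\mathrm{dist}_d(\Phi(s),\Gamma_{\mathcal{T}})\le\eta|Q|\quad\text{for all }s\in 2Q,\ Q\in\mathcal{T}.$$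
   Context: The $n$-th Heisenberg group $\mathbb{H}^n$ is $\mathbb{R}^{2n+1}$ with the group product $$(x_1,\ldots,x_{2n},t)\cdot(x_1',\ldots,x_{2n}',t')=\Big(x_1+x_1',\ldots,x_{2n}+x_{2n}',\,t+t'+\tfrac12\sum_{i=1}^n (x_ix_{n+i}'-x_i'x_{n+i})\Big),$$ with the metric $d(p,q):=\|q^{-1}\cdot p\|$, where $\|(x,t)\|:=\max\{|x|,\sqrt{|t|}\}$ for $(x,t)\in\mathbb{R}^{2n}\times\mathbb{R}$ and $|\cdot|$ is the Euclidean norm; $\mathrm{dist}_d$ is the distance to a set with respect to $d$. A $1$-dimensional horizontal subgroup is $\mathbb{V}=V\times\{0\}$ with $V$ a $1$-dimensional linear subspace of $\mathbb{R}^{2n}$; its complementary vertical subgroup is $\mathbb{W}=V^\perp\times\mathbb{R}$ (Euclidean orthogonal complement in $\mathbb{R}^{2n}$). Every $p\in\mathbb{H}^n$ can be written uniquely as $p=\pi_{\mathbb{V}}(p)\cdot\pi_{\mathbb{W}}(p)$ with $\pi_{\mathbb{V}}(p)\in\mathbb{V}$, $\pi_{\mathbb{W}}(p)\in\mathbb{W}$. A map $\phi:\mathbb{V}\to\mathbb{W}$ is intrinsic $L$-Lipschitz if, with graph map $\Phi(w):=w\cdot\phi(w)$, one has $\|\pi_{\mathbb{W}}(\Phi(w')^{-1}\cdot\Phi(w))\|\le L\|\pi_{\mathbb{V}}(\Phi(w')^{-1}\cdot\Phi(w))\|$ for all $w,w'\in\mathbb{V}$; then $\Gamma=\Phi(\mathbb{V})$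 is called an intrinsic $L$-Lipschitz graph over $\mathbb{V}$. $\mathcal{D}$ is the family of standard dyadic intervals of $\mathbb{R}$, $|Q|$ is the length of $Q$, and $2Q$ is the interval with the same midpoint as $Q$ and twice its length. A collection $\mathcal{T}\subset\mathcal{D}$ is a tree if: (T1) it contains a top interval $Q(\mathcal{T})$, i.e. a unique maximal element; (T2) if $Q\in\mathcal{T}$, then $Q'\in\mathcal{T}$ for all dyadic $Q'$ with $Q\subset Q'\subset Q(\mathcal{T})$; (T3) if $Q\in\mathcal{T}$, then either both or neither of the (dyadic) children of $Q$ lie in $\mathcal{T}$. A decomposition $\mathcal{D}=\mathcal{G}\,\dot\cup\,\mathcal{B}$ (disjoint) is a coronization with constant $C$ if (1) $\sum_{Q\in\mathcal{B},\,Q\subset Q_0}|Q|\le C|Q_0|$ for all $Q_0\in\mathcal{D}$; and (2) $\mathcal{G}$ is the disjoint union of a family (forest) $\mathcal{F}$ of trees with $\sum_{\mathcal{T}\in\mathcal{F},\,Q(\mathcal{T})\subset Q_0}|Q(\mathcal{T})|\le C|Q_0|$ for all $Q_0\in\mathcal{D}$. *)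

(* Defs.v *)
From mathcomp Require Import all_boot all_order all_algebra.
From mathcomp Require Import mathcomp_extra boolp classical_sets functions.
From mathcomp Require Import set_interval reals ereal esum.
From mathcomp Require Import ring.

Set Implicit Arguments.
Unset Strict Implicit.
Unset Printing Implicit Defensive.

Import Order.TTheory GRing.Theory Num.Theory.

Local Open Scope classical_set_scope.
Local Open Scope ring_scope.

Section Heisenberg.
Variables (R : realType) (n : nat).
Implicit Types (x y v : 'rV[R]_(n + n)) (s L : R).

Definition dot x y : R := \sum_i x 0 i * y 0 i.

(* The library norm `|x| on row vectors is the sup norm, hence this one. *)
Definition enorm x : R := Num.sqrt (dot x x).

Definition heis : Type := ('rV[R]_(n + n) * R)%type.
Implicit Types (p q : heis) (phi : heis -> heis).

(* The n left coordinates are x_1, ..., x_n, the right ones x_(n+1), ...,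
   x_(2n). *)
Definition symp x y : R :=
  \sum_(i < n) (x 0 (lshift n i) * y 0 (rshift n i)
                - y 0 (lshift n i) * x 0 (rshift n i)).

Definition hmul p q : heis := (p.1 + q.1, p.2 + q.2 + 2^-1 * symp p.1 q.1).

Definition hone : heis := (0, 0).

Definition hinv p : heis := (- p.1, - p.2).

Definition hnorm p : R := Num.max (enorm p.1) (Num.sqrt `|p.2|).

Definition hdist p q : R := hnorm (hmul (hinv q) p).

(* Only used for nonempty A, where the infimum is that of a nonempty set of
   nonnegative reals. *)
Definition hdist_set p (A : set heis) : R := inf [set hdist p q | q in A].

Definition hline v s : heis := (s *: v, 0).

(* In what follows the vector v is always a unit vector: it represents the
   line V spanned by v. *)
Definition horizontal v : set heis := range (hline v).

Definition vertical v : set heis := [set p | dot p.1 v = 0].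

(* p = hprojV v p * hprojW v p is the only factorization of p into an element
   of horizontal v and an element of vertical v; see hproj_factor and
   hproj_unique below. *)
Definition hprojV v p : heis := hline v (dot p.1 v).

Definition hprojW v p : heis := hmul (hinv (hprojV v p)) p.

Definition graph_map phi p : heis := hmul p (phi p).

(* phi is a total function, of which only the values on horizontal v matter. *)
Definition intrinsic_lipschitz L v phi : Prop :=
  set_fun (horizontal v) (vertical v) phi /\
  forall w w', horizontal v w -> horizontal v w' ->
    let p := hmul (hinv (graph_map phi w')) (graph_map phi w) in
    hnorm (hprojW v p) <= L * hnorm (hprojV v p).

Definition intrinsic_lipschitz_graph L v (A : set heis) : Prop :=
  exists2 phi, intrinsic_lipschitz L v phi & A = graph_map phi @` horizontal v.

Lemma dotDl x y v : dot (x + y) v = dot x v + dot y v.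
Proof. by rewrite -big_split; apply: eq_bigr => i _; rewrite mxE mulrDl. Qed.

Lemma dotZl s x v : dot (s *: x) v = s * dot x v.
Proof. by rewrite mulr_sumr; apply: eq_bigr => i _; rewrite mxE mulrA. Qed.

Lemma enorm1_dot v : enorm v = 1 -> dot v v = 1.
Proof.
move=> /(congr1 (fun r => r ^+ 2)); rewrite expr1n sqr_sqrtr //.
by apply: sumr_ge0 => i _; rewrite -expr2 sqr_ge0.
Qed.

Lemma sympDl x y v : symp (x + y) v = symp x v + symp y v.
Proof. by rewrite -big_split; apply: eq_bigr => i _; rewrite !mxE /=; ring. Qed.

Lemma sympDr x y v : symp v (x + y) = symp v x + symp v y.
Proof. by rewrite -big_split; apply: eq_bigr => i _; rewrite !mxE /=; ring. Qed.

Lemma sympNl x y : symp (- x) y = - symp x y.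
Proof. by rewrite -sumrN; apply: eq_bigr => i _; rewrite !mxE /=; ring. Qed.

Lemma sympxx x : symp x x = 0.
Proof. by rewrite /symp big1 // => i _; rewrite subrr. Qed.

Lemma symp0l x : symp 0 x = 0.
Proof. by rewrite -[0 in LHS](subrr x) sympDl sympNl subrr. Qed.

Lemma symp0r x : symp x 0 = 0.
Proof. by rewrite /symp big1 // => i _; rewrite !mxE mulr0 mul0r subrr. Qed.

Lemma hmulA : associative hmul.
Proof.
move=> p q r; rewrite /hmul /= addrA; congr pair.
by rewrite sympDl sympDr; ring.
Qed.

Lemma hmul1h : left_id hone hmul.
Proof. by case=> x t; rewrite /hmul /= !add0r symp0l mulr0 addr0. Qed.

Lemma hmulh1 : right_id hone hmul.
Proof. by case=> x t; rewrite /hmul /= !addr0 symp0r mulr0 addr0. Qed.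

Lemma hmulVh : left_inverse hone hinv hmul.
Proof.
by case=> x t; rewrite /hmul /= !addNr sympNl sympxx oppr0 mulr0 addr0.
Qed.

Lemma hmulhV : right_inverse hone hinv hmul.
Proof.
case=> x t; rewrite /hmul /= !addrN -[x in symp x]opprK sympNl sympxx.
by rewrite oppr0 mulr0 addr0.
Qed.

Lemma hproj_factor v p : enorm v = 1 ->
  [/\ horizontal v (hprojV v p), vertical v (hprojW v p)
    & p = hmul (hprojV v p) (hprojW v p)].
Proof.
move=> /enorm1_dot v1; split; first by exists (dot p.1 v).
- by rewrite /vertical /= -scaleNr dotDl dotZl v1 mulr1 addNr.
- by rewrite hmulA hmulhV hmul1h.
Qed.

Lemma hproj_unique v p a b : enorm v = 1 ->
  horizontal v a -> vertical v b -> p = hmul a b ->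
  a = hprojV v p /\ b = hprojW v p.
Proof.
move=> /enorm1_dot v1 [s _ <-] bW ->.
have eV : hprojV v (hmul (hline v s) b) = hline v s.
  by rewrite /hprojV /= dotDl dotZl v1 mulr1 bW addr0.
by rewrite /hprojW eV hmulA hmulVh hmul1h.
Qed.

End Heisenberg.

(* The pair (j, k) stands for the interval [k 2^-j, (k + 1) 2^-j[. *)
Definition dyadic : Type := (int * int)%type.

Section Coronization.
Variable R : realType.
Implicit Types (Q : dyadic) (T G B : set dyadic) (F : set (set dyadic)) (C : R).

Definition dlen Q : R := 2 ^ (- Q.1).

Definition dset Q : set R := `[Q.2%:~R * dlen Q, (Q.2 + 1)%:~R * dlen Q[%classic.

Definition dmid Q : R := (Q.2%:~R + 2^-1) * dlen Q.

Definition ddouble Q : set R := `[dmid Q - dlen Q, dmid Q + dlen Q[%classic.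

Definition dsub Q Q' : Prop := dset Q `<=` dset Q'.

Definition child (b : bool) Q : dyadic := (Q.1 + 1, 2 * Q.2 + b%:Z).

Definition is_top T Q : Prop := T Q /\ forall Q', T Q' -> dsub Q' Q.

(* The top is unique when it exists; see is_top_unique below. *)
Definition top T : dyadic := xget ((0, 0) : dyadic) (is_top T).

Definition is_tree T : Prop :=
  [/\ exists Q, is_top T Q,
      forall Q Q', T Q -> dsub Q Q' -> dsub Q' (top T) -> T Q'
    & forall Q, T Q ->
        (T (child false Q) /\ T (child true Q)) \/
        (~ T (child false Q) /\ ~ T (child true Q))].

Definition carleson_packing C (I : choiceType) (D : set I) (q : I -> dyadic) : Prop :=
  forall Q0, (\esum_(i in [set i | D i /\ dsub (q i) Q0]) (dlen (q i))%:E
              <= (C * dlen Q0)%:E)%E.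

Definition is_forest F G : Prop :=
  [/\ forall T, F T -> is_tree T, trivIset F id & \bigcup_(T in F) T = G].

Definition coronization C G B F : Prop :=
  [/\ G `|` B = setT /\ G `&` B = set0,
      carleson_packing C B id,
      is_forest F G
    & carleson_packing C F top].

Lemma dlen_gt0 Q : 0 < dlen Q.
Proof. by rewrite exprz_gt0. Qed.

Lemma dset_itvE Q s :
  dset Q s <-> Q.2%:~R * dlen Q <= s < (Q.2 + 1)%:~R * dlen Q.
Proof. by rewrite /dset /= in_itv. Qed.

Lemma dsubP Q Q' : dsub Q Q' ->
  Q'.2%:~R * dlen Q' <= Q.2%:~R * dlen Q /\
  (Q.2 + 1)%:~R * dlen Q <= (Q'.2 + 1)%:~R * dlen Q'.
Proof.
have := dlen_gt0 Q; rewrite intrD => l0 QQ'; split.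
  have /QQ'/dset_itvE/andP[] // : dset Q (Q.2%:~R * dlen Q).
  by apply/dset_itvE; rewrite lexx intrD ltr_pM2r// ltrDl ltr01.
rewrite leNgt; apply/negP => lt.
set b := (Q.2%:~R + 1%:~R) * dlen Q in lt; set b' := _ * dlen Q' in lt.
have ab : Q.2%:~R * dlen Q < b by rewrite ltr_pM2r// ltrDl ltr01.
have /QQ'/dset_itvE/andP[_] : dset Q (Num.max b' (Q.2%:~R * dlen Q)).
  by apply/dset_itvE; rewrite le_max lexx orbT intrD gt_max lt.
by rewrite -/b' gt_max ltxx.
Qed.

(* Distinct pairs stand for distinct intervals. *)
Lemma dset_inj : injective dset.
Proof.
move=> Q Q' E.
have /dsubP[a1 b1] : dsub Q Q' by rewrite /dsub E.
have /dsubP[a2 b2] : dsub Q' Q by rewrite /dsub E.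
have ea : Q.2%:~R * dlen Q = Q'.2%:~R * dlen Q'.
  by apply/eqP; rewrite eq_le a2 a1.
have eb : (Q.2 + 1)%:~R * dlen Q = (Q'.2 + 1)%:~R * dlen Q'.
  by apply/eqP; rewrite eq_le b1 b2.
have el : dlen Q = dlen Q'.
  by move: eb; rewrite !intrD !mulrDl ea !mul1r => /addrI.
have ek : Q.2 = Q'.2.
  apply/eqP; rewrite -(eqr_int R); apply/eqP.
  by move: ea; rewrite el => /(mulIf (lt0r_neq0 (dlen_gt0 Q'))).
have ej : Q.1 = Q'.1.
  apply: oppr_inj; apply: (@ieexprIz R 2) => //.
  by rewrite gt_eqF // ltr1n.
by move: ek ej; case: Q {E a1 b1 a2 b2 ea eb el} => ? ?; case: Q' => ? ? /= -> ->.
Qed.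

Lemma is_top_unique T Q Q' : is_top T Q -> is_top T Q' -> Q = Q'.
Proof.
move=> [TQ mQ] [TQ' mQ']; apply: dset_inj.
by apply/seteqP; split; [apply: mQ' | apply: mQ].
Qed.

Lemma topE T Q : is_top T Q -> top T = Q.
Proof. by move=> tQ; apply: (is_top_unique _ tQ); apply: xgetPex; exists Q. Qed.

End Coronization.

(* Main.v *)
Require Import Defs.
From mathcomp Require Import all_boot all_order all_algebra.
From mathcomp Require Import boolp classical_sets.
From mathcomp Require Import reals ereal esum fsbigop cardinality finmap.
From mathcomp Require Import zify ring lra.

Set Implicit Arguments.
Unset Strict Implicit.
Unset Printing Implicit Defensive.

Import Order.TTheory GRing.Theory Num.Theory.

Local Open Scope classical_set_scope.
Local Open Scope ring_scope.

(** Write [gamma] for the projection of the graph to the horizontal space.  The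
    intrinsic Lipschitz condition says that [gamma] is a Lipschitz curve and that the
    vertical component of the increment between two points of the graph is at most
    quadratic in their distance.

    Slopes of [gamma] over dyadic intervals form a bounded martingale, so the squares
    of its differences satisfy a Carleson packing condition ([carleson_haar]).  Jumps
    between adjacent intervals without a common parent are recovered from this by a
    recursion with a factor below 1 ([carleson_jump]).  Hence [gamma] is close to a
    segment near all dyadic intervals outside a Carleson family
    ([carleson_nonflat]).  Flatness of [gamma] controls the vertical component as
    well: cut the parameter interval into [N] pieces, use the quadratic bound on each
    piece, and observe that the remaining symplectic area vanishes for a segment
    ([vert_small], [cone_of_flat]).

    The bad intervals are the nonflat ones and those with an endpoint at 0, which
    makes every good interval have a last good ancestor.  Trees are grown downwards
    from good intervals as long as both children are good and their slopes stay close
    to the slope at the top.  When a slope drifts away, the martingale energy spent in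
    the tree pays for the new tops ([drift_step], [carleson_tops]).

    In a tree, let [u] be the direction of the slope at the top.  Take a grid near
    every interval of the tree, with mesh a small fraction of its length, and let [E]
    be the closure of the union.  Any two points of [E] are seen by some interval of
    the tree at the scale of their distance, so the increment of the graph between
    them lies in a narrow cone around [u] ([grid_closure_prec]).  The key point is
    that the cone is chosen to be a semigroup of the Heisenberg group ([cone_mul]).
    The order that it defines is transitive, so the gaps of [E] can be filled one at a
    time: two horizontal segments with a suitable corner join the endpoints of a gap
    ([exists_curve_between]), and horizontal rays extend the curve to infinity.  The
    result meets the original graph at all points of [E], and it is an intrinsic
    Lipschitz graph over the line spanned by [u] with a small constant
    ([exists_lipschitz_graph_through]). *)

(** * Euclidean and symplectic estimates *)

Section Euclid.
Variables (R : realType) (n : nat).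
Implicit Types (x y u : 'rV[R]_(n + n)) (s : R).

Lemma dotC x y : dot x y = dot y x.
Proof. by apply: eq_bigr => i _; rewrite mulrC. Qed.

Lemma dotDr x y u : dot u (x + y) = dot u x + dot u y.
Proof. by rewrite dotC dotDl !(dotC u). Qed.

Lemma dotZr s x u : dot u (s *: x) = s * dot u x.
Proof. by rewrite dotC dotZl (dotC u). Qed.

Lemma dotNl x u : dot (- x) u = - dot x u.
Proof. by rewrite -scaleN1r dotZl mulN1r. Qed.

Lemma dotNr x u : dot u (- x) = - dot u x.
Proof. by rewrite dotC dotNl dotC. Qed.

Lemma dotNN x y : dot (- x) (- y) = dot x y.
Proof. by rewrite dotNl dotNr opprK. Qed.

Lemma dot0l x : dot 0 x = 0.
Proof. by rewrite -(scale0r 0) dotZl mul0r. Qed.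

Definition dotE := (dotDl, dotDr, dotNl, dotNr, dotZl, dotZr).

Lemma dotxx_ge0 x : 0 <= dot x x.
Proof. by apply: sumr_ge0 => i _; rewrite -expr2 sqr_ge0. Qed.

Lemma dotxx_eq0 x : dot x x = 0 -> x = 0.
Proof.
move=> x0; apply/rowP => i; rewrite mxE; apply/eqP.
have := x0; rewrite /dot => /eqP; rewrite psumr_eq0; last first.
  by move=> j _; rewrite -expr2 sqr_ge0.
by move=> /allP /(_ i); rewrite mem_index_enum mulf_eq0 orbb => /(_ isT).
Qed.

Lemma enorm_ge0 x : 0 <= enorm x.
Proof. exact: sqrtr_ge0. Qed.

Lemma enorm_sqr x : enorm x ^+ 2 = dot x x.
Proof. by rewrite sqr_sqrtr // dotxx_ge0. Qed.

Lemma enorm_le x (s : R) : 0 <= s -> (enorm x <= s) = (dot x x <= s ^+ 2).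
Proof. by move=> s0; rewrite -enorm_sqr ler_sqr // nnegrE enorm_ge0. Qed.

Lemma enorm_eq0 x : enorm x <= 0 -> x = 0.
Proof.
move=> x0; apply: dotxx_eq0; rewrite -enorm_sqr; apply/eqP.
by rewrite sqrf_eq0 eq_le x0 enorm_ge0.
Qed.

Lemma dot_cs x y : dot x y <= enorm x * enorm y.
Proof.
have [->|/eqP x0] := eqVneq x 0; first by rewrite dot0l mulr_ge0 ?enorm_ge0.
have xp : 0 < dot x x.
  by rewrite lt_def dotxx_ge0 andbT; apply/eqP => /dotxx_eq0.
rewrite (le_trans (ler_norm _))// -ler_sqr ?nnegrE ?mulr_ge0 ?enorm_ge0//.
rewrite exprMn !enorm_sqr real_normK ?num_real//.
have := dotxx_ge0 (dot x x *: y - dot x y *: x).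
rewrite !dotE (dotC y x) => h.
have : 0 <= dot x x * (dot x x * dot y y - dot x y ^+ 2) by lra.
by rewrite pmulr_rge0// subr_ge0.
Qed.

Lemma dot_abs x y : `|dot x y| <= enorm x * enorm y.
Proof.
rewrite ler_norml dot_cs andbT lerNl -dotNl (le_trans (dot_cs _ _))//.
by rewrite /enorm dotNl dotNr opprK.
Qed.

Lemma enormD x y : enorm (x + y) <= enorm x + enorm y.
Proof.
rewrite enorm_le ?addr_ge0 ?enorm_ge0// !dotE (dotC y x) sqrrD !enorm_sqr.
have := dot_cs x y; lra.
Qed.

Lemma enormN x : enorm (- x) = enorm x.
Proof. by rewrite /enorm !dotE opprK. Qed.

Lemma enormB x y : enorm (x - y) <= enorm x + enorm y.
Proof. by rewrite -(enormN y) enormD. Qed.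

Lemma enormBC x y : enorm (x - y) = enorm (y - x).
Proof. by rewrite -enormN opprB. Qed.

Lemma enormZ s x : enorm (s *: x) = `|s| * enorm x.
Proof. by rewrite /enorm !dotE mulrA -expr2 sqrtrM ?sqr_ge0// sqrtr_sqr. Qed.

Lemma enorm0 : enorm (0 : 'rV[R]_(n + n)) = 0.
Proof. by rewrite -(scale0r 0) enormZ normr0 mul0r. Qed.

(** The complex structure: through [symp_dot] it turns bounds on the symplectic
    form into Cauchy-Schwarz, and [- srot u] is the direction in which a sideways
    step changes the height of a curve heading along [u]. *)
Definition srot x : 'rV[R]_(n + n) := row_mx (rsubmx x) (- lsubmx x).

Lemma symp_dot x y : symp x y = dot x (srot y).
Proof.
rewrite /dot big_split_ord /= -big_split; apply: eq_bigr => i _ /=.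
by rewrite row_mxEl row_mxEr !mxE mulrN [y 0 (lshift n i) * _]mulrC.
Qed.

Lemma srotK x : srot (srot x) = - x.
Proof.
by rewrite /srot row_mxKl row_mxKr -{3}(hsubmxK x) opp_row_mx.
Qed.

Lemma dot_srot x : dot (srot x) (srot x) = dot x x.
Proof.
rewrite /dot !big_split_ord /= addrC; congr (_ + _).
- by apply: eq_bigr => i _; rewrite row_mxEr !mxE mulrNN.
- by apply: eq_bigr => i _; rewrite row_mxEl !mxE.
Qed.

Lemma enorm_srot x : enorm (srot x) = enorm x.
Proof. by rewrite /enorm dot_srot. Qed.

Lemma symp_le x y : `|symp x y| <= enorm x * enorm y.
Proof. by rewrite symp_dot -(enorm_srot y) dot_abs. Qed.

Lemma sympC x y : symp x y = - symp y x.
Proof. by rewrite -sumrN; apply: eq_bigr => i _; ring. Qed.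

Lemma sympZl s x y : symp (s *: x) y = s * symp x y.
Proof. by rewrite !symp_dot dotZl. Qed.

Lemma sympZr s x y : symp x (s *: y) = s * symp x y.
Proof. by rewrite sympC sympZl sympC mulrN opprK. Qed.

Lemma sympNr x y : symp x (- y) = - symp x y.
Proof. by rewrite sympC sympNl -sympC. Qed.

Definition sympE := (@sympDl, @sympDr, @sympNl, @sympNr, @sympZl, @sympZr, @sympxx).

End Euclid.

(** * Curves increasing for a cone of the Heisenberg group *)

Section Cone.
Variables (R : realType) (n : nat) (u : 'rV[R]_(n + n)).
Hypothesis u1 : enorm u = 1.
Implicit Types (p q : heis R n) (x y e w : 'rV[R]_(n + n)) (s r k : R).

(** The height is bounded by [k l ^ 2] and not by [(k l) ^ 2], where [l] is the
    [u]-coordinate.  This makes the cone a semigroup; the price is that an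
    intrinsic [L]-Lipschitz graph needs an opening [k] of order [L ^ 2]. *)
Definition cone k p : Prop :=
  [/\ 0 <= dot p.1 u, enorm (p.1 - dot p.1 u *: u) <= k * dot p.1 u
    & `|p.2| <= k * dot p.1 u ^+ 2].

(** Since [cone] is a semigroup, this is a left-invariant order: a set that is
    increasing for it can be built piece by piece. *)
Definition prec k p q : Prop := cone k (hmul (hinv p) q).

(** In a product the height picks up half the symplectic form of the two base
    points, at most [2 k l m] for [k <= 1], which is the cross term of
    [k (l + m) ^ 2]. *)
Lemma cone_mul k p q : 0 <= k <= 1 -> cone k p -> cone k q -> cone k (hmul p q).
Proof.
move=> /andP[k0 k1]; case: p => x t; case: q => y t'; rewrite /cone /hmul /=.
move=> [l0 w0 t0] [l1 w1 t1]; rewrite dotDl.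
set l := dot x u in l0 w0 t0 *; set m := dot y u in l1 w1 t1 *.
have Ex : x = l *: u + (x - l *: u) by rewrite addrC subrK.
have Ey : y = m *: u + (y - m *: u) by rewrite addrC subrK.
set w := x - _ in w0 Ex; set w' := y - _ in w1 Ey.
have ew := enorm_ge0 w; have ew' := enorm_ge0 w'.
split; first exact: addr_ge0.
- have -> : x + y - (l + m) *: u = w + w'.
    by rewrite /w /w' scalerDl opprD addrACA.
  by rewrite (le_trans (enormD _ _))// mulrDr lerD.
- clearbody w w'.
  have -> : symp x y = l * symp u w' - m * symp u w + symp w w'.
    rewrite [in LHS]Ex [in LHS]Ey !sympE (sympC w u); ring.
  have := symp_le u w'; have := symp_le u w; have := symp_le w w'.
  rewrite u1 !mul1r => h1 h2 h3.
  have h4 : `|l * symp u w'| <= l * (k * m).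
    by rewrite normrM ger0_norm// ler_wpM2l// (le_trans h3).
  have h5 : `|m * symp u w| <= m * (k * l).
    by rewrite normrM ger0_norm// ler_wpM2l// (le_trans h2).
  have h6 : `|symp w w'| <= k * (l * m).
    rewrite (le_trans h1)// (le_trans (ler_pM ew ew' w0 w1))//.
    have -> : k * l * (k * m) = k * (k * (l * m)) by ring.
    by rewrite ler_piMl// !mulr_ge0.
  have -> : k * (l + m) ^+ 2 = k * l ^+ 2 + k * m ^+ 2 + 2 * (k * (l * m)).
    by ring.
  have E : l * (k * m) = k * (l * m) by ring.
  have E' : m * (k * l) = k * (l * m) by ring.
  have h7 : 0 <= k * (l * m) by rewrite !mulr_ge0.
  move: h4 h5 h6 t0 t1; rewrite E E' !ler_norml; lra.
Qed.

Lemma cone_widen k k' p : k <= k' -> cone k p -> cone k' p.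
Proof.
move=> kk' [l0 w0 t0]; split => //.
- by rewrite (le_trans w0)// ler_wpM2r.
- by rewrite (le_trans t0)// ler_wpM2r// sqr_ge0.
Qed.

Lemma cone_horizontal k e s : 0 <= k -> 0 <= s -> dot e u = 1 ->
  enorm (e - u) <= k -> cone k (s *: e, 0).
Proof.
move=> k0 s0 eu ek; rewrite /cone /= dotZl eu mulr1; split => //.
- by rewrite -scalerBr enormZ ger0_norm// mulrC ler_wpM2r.
- by rewrite normr0 mulr_ge0// sqr_ge0.
Qed.

Lemma cone_apex k p : cone k p -> dot p.1 u = 0 -> p = hone R n.
Proof.
case: p => x t [/= _ + +] l0; rewrite l0 scale0r subr0 expr0n /= !mulr0.
by rewrite normr_le0 => /enorm_eq0 -> /eqP ->.
Qed.

Lemma hmulKl p q : hmul (hinv p) (hmul p q) = q.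
Proof. by rewrite hmulA hmulVh hmul1h. Qed.

Lemma hmulVKl p q : hmul p (hmul (hinv p) q) = q.
Proof. by rewrite hmulA hmulhV hmul1h. Qed.

Lemma hinvM p q : hinv (hmul p q) = hmul (hinv q) (hinv p).
Proof.
case: p => x t; case: q => y t'; rewrite /hinv /hmul /=; congr pair.
  by rewrite opprD addrC.
by rewrite !sympE (sympC y x); ring.
Qed.

Lemma prec_mul2l k a p q : prec k (hmul a p) (hmul a q) = prec k p q.
Proof. by rewrite /prec hinvM -hmulA hmulKl. Qed.

Lemma prec_refl k p : prec k p p.
Proof.
rewrite /prec hmulVh /cone /= dot0l scale0r subr0 enorm0 normr0 expr0n.
by rewrite !mulr0.
Qed.

Lemma prec_trans k q p p' : 0 <= k <= 1 ->
  prec k p q -> prec k q p' -> prec k p p'.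
Proof.
move=> k01 pq qp'; rewrite /prec -[X in hmul _ X](hmulVKl q) hmulA.
exact: cone_mul.
Qed.

Lemma prec_widen k k' p q : k <= k' -> prec k p q -> prec k' p q.
Proof. by move=> kk'; apply: cone_widen. Qed.

Lemma prec_le k p q : prec k p q -> dot p.1 u <= dot q.1 u.
Proof. by case; rewrite /= dotDl dotNl addrC subr_ge0. Qed.

Lemma prec_eq k p q : prec k p q -> dot p.1 u = dot q.1 u -> p = q.
Proof.
move=> pq E; have /cone_apex : cone k (hmul (hinv p) q) by [].
rewrite /= dotDl dotNl E addNr => /(_ erefl) h.
by rewrite -(hmulVKl p q) h hmulh1.
Qed.

(** Parametrizing by the [u]-coordinate turns an increasing curve into a graph over
    the line spanned by [u]. *)
Definition curve_on k (D : R -> Prop) (g : R -> heis R n) : Prop :=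
  (forall r, D r -> dot (g r).1 u = r) /\
  (forall r s, D r -> D s -> r <= s -> prec k (g r) (g s)).

Lemma curve_on_glue k (D : R -> Prop) m g1 g2 : 0 <= k <= 1 -> D m ->
  curve_on k (fun r => D r /\ r <= m) g1 ->
  curve_on k (fun r => D r /\ m <= r) g2 -> g1 m = g2 m ->
  curve_on k D (fun r => if r <= m then g1 r else g2 r).
Proof.
move=> k01 Dm [g1u g1p] [g2u g2p] E; split=> [r Dr|r s Dr Ds rs].
  by case: (leP r m) => [rm|/ltW rm]; [apply: g1u|apply: g2u].
case: (leP s m) => [sm|ms].
  have rm := le_trans rs sm.
  by rewrite rm; apply: g1p.
have ms' := ltW ms.
case: (leP r m) => [rm|/ltW rm]; last exact: g2p.
by apply: (prec_trans k01 (q := g1 m)); [exact: g1p|rewrite E; apply: g2p].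
Qed.

Lemma curve_on_segment k a e (D : R -> Prop) : 0 <= k -> dot e u = 1 ->
  enorm (e - u) <= k ->
  curve_on k D (fun r => hmul a ((r - dot a.1 u) *: e, 0)).
Proof.
move=> k0 eu ek; split=> [r _|r s _ _ rs].
  by rewrite /= dotDl dotZl eu mulr1 addrC subrK.
rewrite prec_mul2l /prec /hmul /hinv /=.
rewrite -scaleNr sympE sympE sympxx !mulr0 oppr0 !addr0 -scalerDl.
by apply: cone_horizontal => //; lra.
Qed.

(** Two horizontal segments suffice: pushing their common endpoint sideways by
    [c l] leaves the slopes of order [k + c] and changes the height reached at the
    end by [c] times a quantity of order [l ^ 2], so some [c] of order [k] hits
    the height of [b]. *)
Lemma exists_curve_between k a b : 0 <= k <= 9^-1 -> prec k a b ->
  exists g, [/\ curve_on (9 * k) (fun r => dot a.1 u <= r <= dot b.1 u) g,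
    g (dot a.1 u) = a & g (dot b.1 u) = b].
Proof.
move=> /andP[k0 k1] ab; have := prec_le ab; rewrite le_eqVlt => /orP[/eqP E|lt].
  exists (fun=> a); rewrite -(prec_eq ab E); split=> //; split=> [r|*].
    by rewrite -eq_le => /eqP.
  exact: prec_refl.
have [l0] : cone k (hmul (hinv a) b) := ab; move: l0.
have Eb : b = hmul a (hmul (hinv a) b) by rewrite hmulVKl.
set p := hmul (hinv a) b in Eb *.
have : dot p.1 u = dot b.1 u - dot a.1 u by rewrite /p /= !dotE addrC.
set l := dot b.1 u - dot a.1 u => El; rewrite El.
case: p Eb El => x t /= Eb El _ w0 t0.
have lp : 0 < l by rewrite subr_gt0.
set w := x - l *: u in w0.
have Ex : x = l *: u + w by rewrite addrC subrK.
pose J : 'rV[R]_(n + n) := - srot u.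
have uJ : symp u J = 1 by rewrite sympNr symp_dot srotK dotNr opprK enorm1_dot.
have Ju : dot J u = 0 by rewrite dotC /J dotNr -symp_dot sympxx oppr0.
have J1 : enorm J = 1 by rewrite enormN enorm_srot.
clearbody J.
have : `|symp w J| <= k * l by rewrite (le_trans (symp_le _ _))// J1 mulr1.
rewrite ler_norml => /andP[sw _].
have kl : k * l <= 9^-1 * l by rewrite ler_pM2r.
pose d := l + symp w J.
have dp : l / 2 <= d by rewrite /d; lra.
have dp0 : 0 < d by lra.
have lL : `|t| * 2 <= k * l * (l * 2) by move: t0; rewrite expr2; lra.
(* the sideways displacement, solved from the height [- c l d / 2] of the broken
   line *)
pose c := - 2 * t / (l * d).
have cE : c * l * d = - 2 * t by rewrite /c; field; rewrite !lt0r_neq0.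
have ck : `|c| <= 4 * k.
  rewrite /c !normrM normfV (gtr0_norm (mulr_gt0 lp dp0)) ler_pdivrMr ?mulr_gt0//.
  rewrite normrN normr_nat; have kl0 : 0 <= 4 * k * l by rewrite !mulr_ge0// ltW.
  have := ler_wpM2l kl0 dp; lra.
have wu : dot w u = 0 by rewrite /w !dotE El enorm1_dot// mulr1 subrr.
clearbody w.
pose e1 := l^-1 *: x + (2 * c) *: J; pose e2 := l^-1 *: x - (2 * c) *: J.
have Exl : l^-1 *: x = u + l^-1 *: w.
  by rewrite Ex scalerDr scalerA mulVf ?scale1r// gt_eqF.
have e1u : dot e1 u = 1 by rewrite /e1 Exl !dotE Ju wu enorm1_dot//; lra.
have e2u : dot e2 u = 1 by rewrite /e2 Exl !dotE Ju wu enorm1_dot//; lra.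
have dev (s : R) : `|s| <= 8 * k -> enorm (l^-1 *: x + s *: J - u) <= 9 * k.
  move=> hs; rewrite Exl addrAC [u + _]addrC addrK.
  rewrite (le_trans (enormD _ _))// !enormZ J1 mulr1.
  rewrite [X in X * _]ger0_norm; last by rewrite invr_ge0 ltW.
  have : l^-1 * enorm w <= k by rewrite mulrC ler_pdivrMr.
  by move=> h; rewrite (le_trans (lerD h hs))//; lra.
have e1k : enorm (e1 - u) <= 9 * k by apply: dev; rewrite normrM normr_nat; lra.
have e2k : enorm (e2 - u) <= 9 * k.
  by rewrite /e2 -scaleNr; apply: dev; rewrite normrN normrM normr_nat; lra.
pose m := hmul a ((l / 2) *: e1, 0).
have mu : dot m.1 u = dot a.1 u + l / 2 by rewrite /= dotDl dotZl e1u mulr1.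
have k9 : 0 <= 9 * k <= 1 by lra.
exists (fun r => if r <= dot m.1 u then hmul a ((r - dot a.1 u) *: e1, 0)
                 else hmul m ((r - dot m.1 u) *: e2, 0)); split.
- apply: curve_on_glue => //; first by rewrite mu /l; lra.
  + by apply: curve_on_segment => //; lra.
  + by apply: curve_on_segment => //; lra.
  + rewrite subrr scale0r hmulh1 /m.
    by rewrite (_ : dot m.1 u - _ = l / 2)// mu addrAC subrr add0r.
- by rewrite mu ifT ?subrr ?scale0r ?hmulh1//; lra.
- rewrite mu ifF; last by rewrite /l; apply/negbTE; rewrite -ltNge; lra.
  have -> : dot b.1 u - (dot a.1 u + l / 2) = l / 2 by rewrite /l; lra.
  rewrite Eb /m -hmulA; congr hmul.
  rewrite /hmul /= -scalerDr addr0 add0r; congr pair.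
    rewrite /e1 /e2 addrACA subrr addr0 -scalerDl scalerA.
    by rewrite (_ : l / 2 * _ = 1) ?scale1r//; field; rewrite gt_eqF.
  have xJ : symp x J = d by rewrite Ex sympDl sympZl uJ mulr1.
  rewrite /e1 /e2 !(sympE, sympNr) (sympC J x) xJ.
  transitivity (- (c * l * d) / 2); last by rewrite cE; field.
  by field; rewrite gt_eqF.
Qed.

(** A totally ordered set whose gaps between [p0] and [p1] have both endpoints in
    the set. *)
Definition chain_between k (P : set (heis R n)) p0 p1 : Prop :=
  [/\ forall p q, P p -> P q -> prec k p q \/ prec k q p, P p0, P p1
    & forall r, dot p0.1 u <= r <= dot p1.1 u ->
        exists a b, [/\ P a, P b, dot a.1 u <= r <= dot b.1 u
          & forall q, P q -> dot q.1 u <= dot a.1 u \/ dot b.1 u <= dot q.1 u]].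

(** Fill every gap separately.  Two points of the result are comparable because
    either they lie in the same gap or a point of the chain lies between them, and
    then transitivity applies. *)
Lemma exists_curve_through_chain k P p0 p1 : 0 <= k <= 9^-1 ->
  chain_between k P p0 p1 ->
  exists g, curve_on (9 * k) (fun r => dot p0.1 u <= r <= dot p1.1 u) g /\
    forall p, P p -> dot p0.1 u <= dot p.1 u <= dot p1.1 u ->
      g (dot p.1 u) = p.
Proof.
move=> k01 [Pc P0 P1 Pb]; have k9 : 0 <= 9 * k <= 1 by lra.
have k_9 : k <= 9 * k by lra.
pose I p r q := dot p.1 u <= r <= dot q.1 u.
have Ple p q : P p -> P q -> dot p.1 u <= dot q.1 u -> prec k p q.
  move=> Pp Pq pq; have [//|qp] := Pc _ _ Pp Pq.
  have E : dot q.1 u = dot p.1 u by apply/eqP; rewrite eq_le pq (prec_le qp).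
  by rewrite (prec_eq qp E); exact: prec_refl.
have Peq p q : P p -> P q -> dot p.1 u = dot q.1 u -> p = q.
  by move=> Pp Pq E; apply: (prec_eq (Ple _ _ Pp Pq _) E); rewrite E.
have /choice[f fP] : forall ab : heis R n * heis R n, exists g, prec k ab.1 ab.2 ->
    [/\ curve_on (9 * k) (fun r => I ab.1 r ab.2) g, g (dot ab.1.1 u) = ab.1
      & g (dot ab.2.1 u) = ab.2].
  move=> [a b]; have [ab|nab] := pselect (prec k a b).
    by have [g gP] := exists_curve_between k01 ab; exists g.
  by exists (fun=> a).
have /choice[br brP] : forall r, exists ab : heis R n * heis R n, I p0 r p1 ->
    [/\ P ab.1, P ab.2, I ab.1 r ab.2
      & forall q, P q -> dot q.1 u <= dot ab.1.1 u \/ dot ab.2.1 u <= dot q.1 u].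
  move=> r; have [/Pb[a [b ?]]|] := pselect (I p0 r p1); first by exists (a, b).
  by exists (p0, p1).
pose g r := f (br r) r.
have fbr r : I p0 r p1 ->
    [/\ curve_on (9 * k) (fun s => I (br r).1 s (br r).2) (f (br r)),
      f (br r) (dot (br r).1.1 u) = (br r).1 &
      f (br r) (dot (br r).2.1 u) = (br r).2].
  move=> /brP[Pa Pb' /andP[ar rb] _]; apply: fP; apply: Ple => //.
  exact: le_trans ar rb.
have Il p q r : I p r q -> I p (dot p.1 u) q.
  by move=> /andP[pr rq]; rewrite /I lexx (le_trans pr rq).
have Ir p q r : I p r q -> I p (dot q.1 u) q.
  by move=> /andP[pr rq]; rewrite /I lexx (le_trans pr rq).
have ga r : I p0 r p1 -> prec (9 * k) (br r).1 (g r).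
  move=> Hr; have [_ _ Ir' _] := brP _ Hr; have [[_ fm] fa _] := fbr _ Hr.
  rewrite -{1}fa; apply: fm => //; first exact: Il Ir'.
  by case/andP: Ir'.
have gb r : I p0 r p1 -> prec (9 * k) (g r) (br r).2.
  move=> Hr; have [_ _ Ir' _] := brP _ Hr; have [[_ fm] _ fb] := fbr _ Hr.
  rewrite -[X in prec _ _ X]fb; apply: fm => //; first exact: Ir Ir'.
  by case/andP: Ir'.
have gu r : I p0 r p1 -> dot (g r).1 u = r.
  by move=> Hr; have [_ _ Ir' _] := brP _ Hr; have [[-> //]] := fbr _ Hr.
have gP p : P p -> I p0 (dot p.1 u) p1 -> g (dot p.1 u) = p.
  move=> Pp Hr; have [Pa Pb' /andP[ar rb] /(_ p Pp)[h|h]] := brP _ Hr.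
    have E : dot (br (dot p.1 u)).1.1 u = dot p.1 u by apply/eqP; rewrite eq_le ar h.
    by rewrite /g -{2}E; have [_ -> _] := fbr _ Hr; apply: Peq.
  have E : dot (br (dot p.1 u)).2.1 u = dot p.1 u by apply/eqP; rewrite eq_le rb h.
  by rewrite /g -{2}E; have [_ _ ->] := fbr _ Hr; apply: Peq.
exists g; split=> //; split=> // r s Hr Hs rs.
have [Pra Prb /andP[ra rb] rg] := brP _ Hr.
have [Psa Psb /andP[sa sb] sg] := brP _ Hs.
have [bs|sb'] := leP (dot (br r).2.1 u) s.
  (* a point of the chain lies between the two parameters *)
  apply: (prec_trans k9 (gb _ Hr)).
  have [h|h] := sg _ Prb.
    by apply: (prec_trans k9 _ (ga _ Hs)); apply: prec_widen k_9 (Ple _ _ _ _ h).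
  have E : s = dot (br r).2.1 u by apply/eqP; rewrite eq_le bs (le_trans sb h).
  by rewrite E gP -?E//; exact: prec_refl.
have := rs; rewrite le_eqVlt => /orP[/eqP -> | lrs]; first exact: prec_refl.
(* both parameters lie in the same gap of the chain *)
have EA : (br r).1 = (br s).1.
  apply: Peq => //; apply/eqP; rewrite eq_le; apply/andP; split.
    by case: (sg _ Pra) => // h; move: (le_trans h ra) sb lrs; lra.
  by case: (rg _ Psa) => // h; move: (le_trans h sa) sb'; lra.
have EB : (br r).2 = (br s).2.
  apply: Peq => //; apply/eqP; rewrite eq_le; apply/andP; split.
    by case: (rg _ Psb) => // h; move: (le_trans h ra) sb lrs; lra.
  by case: (sg _ Prb) => // h; move: (le_trans h sa) sb'; lra.
have Ebr : br r = br s.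
  by rewrite (surjective_pairing (br r)) EA EB -surjective_pairing.
have [[_ fm] _ _] := fbr _ Hs; rewrite /g Ebr; apply: fm => //.
  by rewrite /I -EA -EB ra.
by rewrite /I sa.
Qed.

(** Horizontal rays in the direction [u] continue a curve at both ends. *)
Lemma curve_on_extend k a b g : 0 <= k <= 1 -> a <= b ->
  curve_on k (fun r => a <= r <= b) g ->
  exists2 g', curve_on k (fun=> True) g' & forall r, a <= r <= b -> g' r = g r.
Proof.
move=> k01 ab [gu gm]; have k0 : 0 <= k by case/andP: k01.
have uu : dot u u = 1 by rewrite enorm1_dot.
have u0 : enorm (u - u) <= k by rewrite subrr enorm0.
have Ia : a <= a <= b by rewrite lexx.
have Ib : a <= b <= b by rewrite lexx ab.
pose ray c r := hmul (g c) ((r - dot (g c).1 u) *: u, 0).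
have rayE c : dot (g c).1 u = c -> ray c c = g c.
  by move=> E; rewrite /ray E subrr scale0r hmulh1.
pose h r := if r <= b then g r else ray b r.
have hP : curve_on k (fun r => True /\ a <= r) h.
  apply: curve_on_glue => //; last by rewrite rayE ?gu.
    split=> [r [[_ ar] rb]|r s [[_ ar] rb] [[_ as_] sb]]; first by apply: gu; rewrite ar.
    by apply: gm; rewrite ?ar ?as_.
  exact: curve_on_segment.
exists (fun r => if r <= a then ray a r else h r).
  apply: curve_on_glue => //; first exact: curve_on_segment.
  by rewrite rayE ?gu// /h ab.
move=> r /andP[ar rb]; rewrite /h rb; case: ifP => // ra.
by rewrite (_ : r = a) ?rayE ?gu//; apply/eqP; rewrite eq_le ra.
Qed.

(** The height of the vertical projection of [p] differs from [p.2] by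
    [l * symp u p.1 / 2], where only the part of [p.1] orthogonal to [u] counts;
    hence the factor 3/2. *)
Lemma curve_intrinsic_lipschitz k L g : 0 <= L -> 0 <= k ->
  k <= L -> 3 / 2 * k <= L ^+ 2 -> curve_on k (fun=> True) g ->
  intrinsic_lipschitz_graph L u (range g).
Proof.
move=> L0 k0 kL k32 [gu gm].
have uu : dot u u = 1 by rewrite enorm1_dot.
have lu r : dot (hline u r).1 u = r by rewrite /= dotZl uu mulr1.
pose phi (w : heis R n) := hmul (hinv w) (g (dot w.1 u)).
have phiE r : graph_map phi (hline u r) = g r.
  by rewrite /graph_map /phi hmulVKl lu.
exists phi; last first.
  rewrite eqEsubset; split=> p /=.
    by move=> [r _ <-]; exists (hline u r); [exists r|rewrite phiE].
  by move=> [_ [r _ <-] <-]; exists r; rewrite ?phiE.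
split=> [_ [r _ <-]|_ _ [r _ <-] [s _ <-]].
  by rewrite /vertical /phi lu /= dotDl gu// dotNl dotZl uu mulr1 addNr.
rewrite /= !phiE.
have main r' s' : s' <= r' -> prec k (g s') (g r') by move=> ?; apply: gm.
set p := hmul _ _.
have [w0 t0] : enorm (p.1 - dot p.1 u *: u) <= k * `|dot p.1 u| /\
    `|p.2| <= k * `|dot p.1 u| ^+ 2.
  have [/main[l0 w0 t0]|/ltW /main[l0 w0 t0]] := leP s r.
    by rewrite -/p in l0 w0 t0; rewrite ger0_norm.
  have Ep : hmul (hinv (g r)) (g s) = hinv p.
    by rewrite /p hinvM /hinv /= !opprK; case: (g r).
  move: l0 w0 t0; rewrite Ep /= dotNl scaleNr -opprD enormN normrN => l0 w0 t0.
  by rewrite ler0_norm//; lra.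
clearbody p; set l := dot p.1 u in w0 t0 *.
have -> : hnorm (hprojV u p) = `|l|.
  rewrite /hnorm /hprojV /= enormZ u1 mulr1 normr0 sqrtr0.
  exact: max_l.
have sw : `|symp u p.1| <= k * `|l|.
  have -> : symp u p.1 = symp u (p.1 - l *: u).
    by rewrite sympDr sympNr sympZr sympxx mulr0 subr0.
  by rewrite (le_trans (symp_le _ _))// u1 mul1r.
rewrite /hnorm /hprojW /hprojV /hmul /hinv /= -/l ge_max; apply/andP; split.
  by rewrite addrC (le_trans w0)// ler_wpM2r.
rewrite oppr0 add0r sympNl sympZl.
rewrite -ler_sqr ?nnegrE ?sqrtr_ge0 ?mulr_ge0// sqr_sqrtr// exprMn.
rewrite (@le_trans _ _ (3 / 2 * k * `|l| ^+ 2))//; last by rewrite ler_wpM2r// sqr_ge0.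
have : `|l * symp u p.1| <= k * `|l| ^+ 2.
  by rewrite normrM expr2 mulrCA ler_wpM2l.
move: t0; rewrite !ler_norml; lra.
Qed.

End Cone.

(** * Carleson weights on the dyadic intervals *)

Section CarlesonWeights.
Variable R : realType.
Implicit Types (f g U : dyadic -> R) (Q P : dyadic) (C : R) (N m : nat).

Definition shift (l : int) Q : dyadic := (Q.1, Q.2 + l).

Definition lchild Q : dyadic := child false Q.
Definition rchild Q : dyadic := child true Q.

Lemma dlen_child b Q : dlen R (child b Q) = dlen R Q / 2.
Proof. by rewrite /dlen /= opprD expfzDr ?pnatr_eq0// exprN1. Qed.

Lemma dlen_shift l Q : dlen R (shift l Q) = dlen R Q.
Proof. by []. Qed.

Lemma shiftD l l' Q : shift l (shift l' Q) = shift (l' + l) Q.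
Proof. by rewrite /shift /= addrA. Qed.

Lemma shift0 Q : shift 0 Q = Q.
Proof. by case: Q => j k; rewrite /shift addr0. Qed.

Lemma shift_lchild Q : shift 1 (lchild Q) = rchild Q.
Proof. by rewrite /shift /lchild /rchild /child /= addr0. Qed.

Lemma shift_rchild Q : shift 1 (rchild Q) = lchild (shift 1 Q).
Proof. by rewrite /shift /lchild /rchild /child /= addr0 mulrDr mulr1 -addrA. Qed.

Lemma shiftN_rchild Q : shift (-1) (rchild Q) = lchild Q.
Proof. by rewrite -shift_lchild shiftD subrr shift0. Qed.

Lemma shiftN_lchild Q : shift (-1) (lchild Q) = rchild (shift (-1) Q).
Proof.
rewrite -[in lchild Q](shift0 Q) -(subrr 1) addrC -shiftD -shift_rchild shiftD.
by rewrite subrr shift0.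
Qed.

Fixpoint treesum f N Q : R :=
  if N is N'.+1 then f Q + (treesum f N' (lchild Q) + treesum f N' (rchild Q))
  else 0.

Definition nneg f : Prop := forall Q, 0 <= f Q.

Lemma treesum_ge0 f N Q : nneg f -> 0 <= treesum f N Q.
Proof. by move=> f0; elim: N Q => //= N IH Q; rewrite !addr_ge0. Qed.

Lemma le_treesum f g N Q : (forall P, f P <= g P) -> treesum f N Q <= treesum g N Q.
Proof. by move=> fg; elim: N Q => //= N IH Q; rewrite !lerD. Qed.

Lemma treesumD f g N Q :
  treesum (fun P => f P + g P) N Q = treesum f N Q + treesum g N Q.
Proof. by elim: N Q => [|N IH] Q /=; rewrite ?IH; ring. Qed.

Lemma treesumM C f N Q : treesum (fun P => C * f P) N Q = C * treesum f N Q.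
Proof. by elim: N Q => [|N IH] Q /=; rewrite ?IH; ring. Qed.

Lemma treesumS f N Q : treesum f N.+1 Q =
  f Q + treesum (fun P => f (lchild P) + f (rchild P)) N Q.
Proof.
elim: N Q => [|N IH] Q; first by rewrite /= !addr0.
by rewrite [LHS]/= -/(treesum f N.+1 _) -/(treesum f N.+1 _) !IH /=; ring.
Qed.

Lemma treesum_leS f N Q : nneg f -> treesum f N Q <= treesum f N.+1 Q.
Proof.
move=> f0; elim: N Q => [|N IH] Q; first by rewrite /= !addr_ge0.
by rewrite [leRHS]/= lerD2l lerD// IH.
Qed.

Lemma treesum_potential f U N Q : nneg U ->
  (forall P, f P + (U (lchild P) + U (rchild P)) <= U P) -> treesum f N Q <= U Q.
Proof.
move=> U0 fU; elim: N Q => [//|N IH] Q /=.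
by rewrite (le_trans _ (fU Q))// lerD2l lerD.
Qed.

(** A Carleson packing condition for weights in place of sets: weights can be
    compared, added and moved to neighbours or descendants. *)
Definition carleson C f : Prop :=
  nneg f /\ forall N Q, treesum f N Q <= C * dlen R Q.

Lemma carleson_le C C' f g : nneg f -> 0 <= C' -> (forall Q, f Q <= C' * g Q) ->
  carleson C g -> carleson (C' * C) f.
Proof.
move=> f0 C'0 fg [g0 gC]; split=> // N Q.
rewrite (le_trans (le_treesum _ _ fg))//.
by rewrite treesumM -mulrA ler_wpM2l.
Qed.

Lemma carleson_mono C C' f : C <= C' -> carleson C f -> carleson C' f.
Proof.
move=> CC [f0 fC]; split=> // N Q; rewrite (le_trans (fC N Q))// ler_wpM2r//.
by rewrite ltW// dlen_gt0.
Qed.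

Lemma carlesonD C C' f g : carleson C f -> carleson C' g ->
  carleson (C + C') (fun Q => f Q + g Q).
Proof.
move=> [f0 fC] [g0 gC]; split=> [Q|N Q]; first exact: addr_ge0.
by rewrite treesumD mulrDl lerD.
Qed.

Lemma carleson_potential C f U : nneg f -> nneg U ->
  (forall P, f P + (U (lchild P) + U (rchild P)) <= U P) ->
  (forall P, U P <= C * dlen R P) -> carleson C f.
Proof.
by move=> f0 U0 fU UC; split=> // N Q; rewrite (le_trans (treesum_potential _ _ U0 fU)).
Qed.

(** The descendants of [Q] that share an endpoint with [Q]: shifting a sum over
    descendants by one interval exchanges one such chain for another. *)
Fixpoint chainsum (b : bool) f N Q : R :=
  if N is N'.+1 then f Q + chainsum b f N' (child b Q) else 0.

Lemma chainsum_ge0 b f N Q : nneg f -> 0 <= chainsum b f N Q.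
Proof. by move=> f0; elim: N Q => //= N IH Q; rewrite addr_ge0. Qed.

Lemma chainsum_le b f N Q : nneg f -> chainsum b f N Q <= treesum f N Q.
Proof.
move=> f0; elim: N Q => //= N IH Q; rewrite lerD2l.
case: b IH => IH; first by rewrite -[leLHS]add0r lerD// treesum_ge0.
by rewrite -[leLHS]addr0 lerD// treesum_ge0.
Qed.

Lemma treesum_shiftr f N Q : treesum (fun P => f (shift 1 P)) N Q =
  treesum f N Q - chainsum false f N Q + chainsum false f N (shift 1 Q).
Proof.
elim: N Q => [|N IH] Q; first by rewrite /= subrr add0r.
by rewrite /= !IH shift_lchild shift_rchild -!/(lchild _); ring.
Qed.

Lemma treesum_shiftl f N Q : treesum (fun P => f (shift (-1) P)) N Q =
  treesum f N Q - chainsum true f N Q + chainsum true f N (shift (-1) Q).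
Proof.
elim: N Q => [|N IH] Q; first by rewrite /= subrr add0r.
by rewrite /= !IH shiftN_lchild shiftN_rchild -!/(rchild _); ring.
Qed.

Lemma carleson_shiftr C f : carleson C f -> carleson (2 * C) (fun P => f (shift 1 P)).
Proof.
move=> [f0 fC]; split=> [Q|N Q]; first exact: f0.
rewrite treesum_shiftr; have := chainsum_ge0 false N Q f0.
have := le_trans (chainsum_le false N (shift 1 Q) f0) (fC N (shift 1 Q)).
have := fC N Q; rewrite dlen_shift; lra.
Qed.

Lemma carleson_shiftl C f : carleson C f -> carleson (2 * C) (fun P => f (shift (-1) P)).
Proof.
move=> [f0 fC]; split=> [Q|N Q]; first exact: f0.
rewrite treesum_shiftl; have := chainsum_ge0 true N Q f0.
have := le_trans (chainsum_le true N (shift (-1) Q) f0) (fC N (shift (-1) Q)).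
have := fC N Q; rewrite dlen_shift; lra.
Qed.

(** A shift by [m] intervals is harmless for a packing condition, since the shifted
    descendants of [Q] stay within [m] neighbours of [Q]. *)
Lemma carleson_shift (m : nat) C f : carleson C f ->
  carleson (2 ^+ m * C) (fun P => f (shift m%:Z P)) /\
  carleson (2 ^+ m * C) (fun P => f (shift (- m%:Z) P)).
Proof.
move=> fC; elim: m => [|m [IH1 IH2]].
  by rewrite expr0 mul1r oppr0; split; under eq_fun do rewrite shift0.
rewrite exprS -mulrA; split.
  move/carleson_shiftr: IH1; congr carleson; apply/funext => P.
  by rewrite shiftD -intS.
move/carleson_shiftl: IH2; congr carleson; apply/funext => P.
by rewrite shiftD intS opprD.
Qed.

Fixpoint gensum f m Q : R :=
  if m is m'.+1 then gensum f m' (lchild Q) + gensum f m' (rchild Q) else f Q.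

Lemma gensum_ge0 f m : nneg f -> nneg (gensum f m).
Proof. by move=> f0; elim: m => //= m IH Q; rewrite addr_ge0. Qed.

Lemma gensum_ge f m (r : nat) Q : nneg f -> (r < 2 ^ m)%N ->
  f (Q.1 + m%:Z, 2 ^+ m * Q.2 + r%:Z) <= gensum f m Q.
Proof.
move=> f0; elim: m r Q => [|m IH] r [j k] /=.
  by rewrite ltnS leqn0 => /eqP ->; rewrite !addr0 mul1r.
rewrite expnS mul2n -addnn => rm.
have [rl|rl] := ltnP r (2 ^ m).
  rewrite -[leLHS]addr0 lerD ?gensum_ge0//.
  have := IH _ (lchild (j, k)) rl; rewrite /= addr0; congr (f (_, _) <= _).
    by rewrite intS; ring.
  by rewrite exprS; ring.
rewrite -[leLHS]add0r lerD ?gensum_ge0//.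
have rl' : (r - 2 ^ m < 2 ^ m)%N by rewrite ltn_subLR.
have := IH _ (rchild (j, k)) rl'; rewrite /=; congr (f (_, _) <= _).
  by rewrite intS; ring.
by rewrite -subzn// -[(2 ^ m)%:Z]natz natrX exprS; ring.
Qed.

Lemma carleson_gensum m C f : carleson C f -> carleson C (gensum f m).
Proof.
move=> fC; have f0 := fC.1; elim: m => [//|m [g0 gC]]; split=> [|N Q].
  exact: (@gensum_ge0 f m.+1).
apply: le_trans (gC N.+1 Q); rewrite treesumS -[leLHS]add0r lerD//.
Qed.

Lemma carleson0 : carleson 0 (fun=> 0).
Proof.
split=> // N Q; rewrite mul0r; elim: N Q => //= N IH Q.
by have := IH (lchild Q); have := IH (rchild Q); lra.
Qed.

Lemma carleson_sum K (C : nat -> R) (f : nat -> dyadic -> R) :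
  (forall q, carleson (C q) (f q)) ->
  carleson (\sum_(q < K) C q) (fun Q => \sum_(q < K) f q Q).
Proof.
move=> fC; elim: K => [|K IH].
  by rewrite big_ord0; under eq_fun do rewrite big_ord0; exact: carleson0.
rewrite big_ord_recr /=.
have -> : (fun Q => \sum_(q < K.+1) f q Q) = (fun Q => \sum_(q < K) f q Q + f K Q).
  by apply/funext => Q; rewrite big_ord_recr.
exact: carlesonD.
Qed.

Lemma dlen_gen Q (m : nat) k : dlen R (Q.1 + m%:Z, k) = dlen R Q / 2 ^+ m.
Proof. by rewrite /dlen /= opprD expfzDr ?pnatr_eq0// -exprnN. Qed.

Definition weight (X : dyadic -> Prop) Q : R := if `[< X Q >] then dlen R Q else 0.

Lemma weight_ge0 X : nneg (weight X).
Proof. by move=> Q; rewrite /weight; case: asboolP => // _; rewrite ltW ?dlen_gt0. Qed.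

Lemma weight_le X Q : weight X Q <= dlen R Q.
Proof. by rewrite /weight; case: asboolP => // _; rewrite ltW ?dlen_gt0. Qed.

End CarlesonWeights.

(** * The square function of a Lipschitz curve *)

Section SquareFunction.
Variables (R : realType) (n : nat) (gam : R -> 'rV[R]_(n + n)).
Hypothesis gam_lip : forall s s', enorm (gam s - gam s') <= 2 * `|s - s'|.
Implicit Types (Q P : dyadic).

Definition lft Q : R := Q.2%:~R * dlen R Q.

Lemma lft_lchild Q : lft (lchild Q) = lft Q.
Proof. by rewrite /lft dlen_child /= addr0 intrM; field. Qed.

Lemma lft_rchild Q : lft (rchild Q) = lft Q + dlen R Q / 2.
Proof. by rewrite /lft dlen_child /= intrD intrM; field. Qed.

Definition slope Q : 'rV[R]_(n + n) :=
  (dlen R Q)^-1 *: (gam (lft Q + dlen R Q) - gam (lft Q)).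

Lemma slope_avg Q : slope Q = 2^-1 *: (slope (lchild Q) + slope (rchild Q)).
Proof.
rewrite /slope lft_lchild lft_rchild !dlen_child.
have -> : lft Q + dlen R Q / 2 + dlen R Q / 2 = lft Q + dlen R Q by field.
rewrite -scalerDr scalerA [X in _ = _ *: X]addrC addrA subrK; congr (_ *: _).
by field; rewrite gt_eqF ?dlen_gt0.
Qed.

Lemma enorm_slope Q : enorm (slope Q) <= 2.
Proof.
have l0 := dlen_gt0 R Q.
rewrite enormZ ger0_norm ?invr_ge0 ?(ltW l0)// mulrC ler_pdivrMr//.
by rewrite (le_trans (gam_lip _ _))// addrAC subrr add0r gtr0_norm.
Qed.

(** A potential: slopes have norm at most 2, and passing to the two children costs
    exactly the energy [haar Q] by orthogonality. *)
Definition defect Q : R := (4 - dot (slope Q) (slope Q)) * dlen R Q.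

(** The energy of the martingale difference of the slopes at [Q]. *)
Definition haar Q : R :=
  let d := slope (lchild Q) - slope (rchild Q) in dot d d / 4 * dlen R Q.

Definition jump Q : R :=
  let d := slope Q - slope (shift 1 Q) in dot d d * dlen R Q.

Lemma defect_ge0 : nneg defect.
Proof.
move=> Q; rewrite mulr_ge0 ?(ltW (dlen_gt0 _ _))// subr_ge0.
have := enorm_slope Q; rewrite enorm_le//; lra.
Qed.

Lemma defect_le Q : defect Q <= 4 * dlen R Q.
Proof. by rewrite ler_pM2r ?dlen_gt0// lerBlDr lerDl dotxx_ge0. Qed.

Lemma haar_ge0 : nneg haar.
Proof. by move=> Q; rewrite mulr_ge0 ?divr_ge0 ?dotxx_ge0 ?(ltW (dlen_gt0 _ _)). Qed.

Lemma jump_ge0 : nneg jump.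
Proof. by move=> Q; rewrite mulr_ge0 ?dotxx_ge0 ?(ltW (dlen_gt0 _ _)). Qed.

Lemma defect_haar Q :
  defect Q = haar Q + (defect (lchild Q) + defect (rchild Q)).
Proof.
rewrite /defect /haar (slope_avg Q) !dlen_child.
move: (slope (lchild Q)) (slope (rchild Q)) => A B; rewrite !dotE (dotC B A).
by field.
Qed.

Lemma carleson_haar : carleson 4 haar.
Proof.
apply: (carleson_potential haar_ge0 defect_ge0) => [P|]; last exact: defect_le.
by rewrite -defect_haar.
Qed.

Lemma dot_triple_le (x y z : 'rV[R]_(n + n)) :
  dot (x + y + z) (x + y + z) <= 3 / 2 * dot x x + 6 * dot y y + 6 * dot z z.
Proof.
have := dotxx_ge0 (x - 2 *: (y + z)); have := dotxx_ge0 (y - z).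
rewrite !dotE (dotC y x) (dotC z x) (dotC z y); lra.
Qed.

(** The jump across the midpoint of [Q] is a martingale difference, and the
    interval carrying the jump across the right endpoint of [Q] is halved, which
    leaves a factor below 1 for absorption. *)
Lemma jump_children Q : jump (lchild Q) + jump (rchild Q) <=
  3 / 4 * jump Q + (5 * haar Q + 3 * haar (shift 1 Q)).
Proof.
have -> : jump (lchild Q) = 2 * haar Q.
  by rewrite /jump /haar shift_lchild dlen_child; field.
have : jump (rchild Q) <= 3 / 4 * jump Q + 3 * haar Q + 3 * haar (shift 1 Q).
  rewrite /jump /haar shift_rchild dlen_child dlen_shift.
  set Q' := shift 1 Q; rewrite (slope_avg Q) (slope_avg Q').
  set A := slope (lchild Q); set B := slope (rchild Q).
  set C := slope (lchild Q'); set D := slope (rchild Q').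
  clearbody A B C D.
  have l0 := dlen_gt0 R Q.
  have := dot_triple_le (2^-1 *: (A + B) - 2^-1 *: (C + D)) (2^-1 *: (B - A))
    (2^-1 *: (D - C)).
  have -> : 2^-1 *: (A + B) - 2^-1 *: (C + D) + 2^-1 *: (B - A) + 2^-1 *: (D - C) = B - C.
    by apply/rowP => i; rewrite !mxE; field.
  rewrite !(dotZl, dotZr) -(dotNN (B - A)) opprB -(dotNN (D - C)) opprB.
  by move=> /(ler_wpM2r (ltW l0)); lra.
lra.
Qed.

(** Summing [jump_children] over all generations bounds the sum of the jumps by
    three quarters of itself plus martingale energy.  The jumps between neighbours
    that have no common parent are what the martingale alone does not see. *)
Lemma carleson_jump : carleson 240 jump.
Proof.
have [_ hC] := carleson_haar; have [_ hC'] := carleson_shiftr carleson_haar.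
split=> [|N Q]; first exact: jump_ge0.
have h1 := treesum_leS N Q jump_ge0.
have := le_treesum N Q jump_children.
rewrite !treesumD !treesumM => h2.
have h3 : jump Q <= 16 * dlen R Q.
  rewrite ler_pM2r ?dlen_gt0// [leRHS](_ : _ = 4 ^+ 2); last by ring.
  rewrite -enorm_le// (le_trans (enormB _ _))//.
  have := enorm_slope Q; have := enorm_slope (shift 1 Q); lra.
move: h1 (hC N Q) (hC' N Q); rewrite treesumS treesumD; lra.
Qed.

(** The window reaches far beyond [Q] so that one interval sees pairs of points that
    lie in different but nearby intervals; an error proportional to the length of
    [Q] suffices, as pairs are used at the scale of their own distance. *)
Definition flat (e : R) Q : Prop := forall s s',
  `|s - lft Q| <= 4 * dlen R Q -> `|s' - lft Q| <= 4 * dlen R Q ->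
  enorm (gam s - gam s' - (s - s') *: slope Q) <= e * dlen R Q.

(** For [j] below [8 * 2 ^ m] these intervals tile the window of [flat]. *)
Definition window (m : nat) Q (j : nat) : dyadic :=
  (Q.1 + m%:Z, 2 ^+ m * (Q.2 - 4) + j%:Z).

Lemma lft_window m Q j :
  lft (window m Q j) = lft Q - 4 * dlen R Q + j%:R * (dlen R Q / 2 ^+ m).
Proof.
rewrite /lft dlen_gen /= intrD intrM intrB rmorphXn /= pmulrn.
by field; rewrite expf_neq0// pnatr_eq0.
Qed.

Lemma window_shift m Q j : shift 1 (window m Q j) = window m Q j.+1.
Proof. by rewrite /shift /window /= -addrA intS [1 + _]addrC. Qed.

(** With [M] intervals in the window and jumps at most [M ^ -2], all slopes in the
    window agree up to [1 / M], so at the points of the fine grid the curve is affine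
    up to one grid length; Lipschitz continuity does the rest. *)
Lemma flat_of_jumps m Q (M := (8 * 2 ^ m)%N) :
  (forall j, (j < M)%N ->
     jump (window m Q j) <= (M%:R ^- 2) ^+ 2 * dlen R (window m Q j)) ->
  flat (90 / 2 ^+ m) Q.
Proof.
move=> small.
have M0 : (0 < M)%N by rewrite muln_gt0 expn_gt0.
have M0R : 0 < M%:R :> R by rewrite ltr0n.
have ME : M%:R = 8 * 2 ^+ m :> R by rewrite /M natrM natrX.
clearbody M.
have l0 := dlen_gt0 R Q; set d := dlen R Q / 2 ^+ m.
have d0 : 0 < d by rewrite divr_gt0// exprn_gt0.
pose p j := lft (window m Q j); pose a := slope (window m Q 0).
have pS j : p j.+1 = p j + d by rewrite /p !lft_window -/d -natr1; ring.
have p0 : p 0 = lft Q - 4 * dlen R Q by rewrite /p lft_window mul0r addr0.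
have e0 : 0 <= M%:R ^- 2 :> R by rewrite invr_ge0 exprn_ge0 ?ler0n.
have slopes j : (j <= M)%N -> enorm (slope (window m Q j) - a) <= j%:R * M%:R ^- 2.
  elim: j => [|j IH] jM; first by rewrite subrr enorm0 mul0r.
  have := small j jM; rewrite /jump /= window_shift ler_pM2r ?dlen_gt0//.
  rewrite -enorm_le// enormBC => h.
  rewrite -(subrK (slope (window m Q j)) (slope _)) -addrA -natr1 mulrDl mul1r addrC.
  by rewrite (le_trans (enormD _ _))// lerD ?IH// ltnW.
have steps j : (j <= M)%N ->
    enorm (gam (p j) - gam (p 0) - (j%:R * d) *: a) <= j%:R * (d / M%:R).
  elim: j => [|j IH] jM; first by rewrite subrr !mul0r scale0r subr0 enorm0.
  have E : gam (p j.+1) = gam (p j) + d *: slope (window m Q j).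
    rewrite /slope dlen_gen -/d -/(p j) -pS scalerA mulfV ?gt_eqF// scale1r.
    by rewrite addrC subrK.
  have -> : gam (p j.+1) - gam (p 0) - (j.+1%:R * d) *: a =
      (gam (p j) - gam (p 0) - (j%:R * d) *: a) + d *: (slope (window m Q j) - a).
    by rewrite E -natr1; apply/rowP => i; rewrite !mxE; ring.
  apply: le_trans (enormD _ _) _.
  have -> : j.+1%:R * (d / M%:R) = j%:R * (d / M%:R) + d / M%:R by rewrite -natr1; ring.
  apply: lerD; first exact: IH (ltnW jM).
  rewrite enormZ gtr0_norm// ler_pM2l// (le_trans (slopes j (ltnW jM)))//.
  by rewrite ler_pdivrMr ?exprn_gt0// expr2 mulKf ?gt_eqF// ler_nat ltnW.
have near s : `|s - lft Q| <= 4 * dlen R Q ->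
    enorm (gam s - gam (p 0) - (s - p 0) *: a) <= 5 * d.
  rewrite ler_norml => /andP[s1 s2].
  have x0 : 0 <= (s - p 0) / d by rewrite divr_ge0 ?(ltW d0)// p0; lra.
  have := truncn_itv x0; set j := Num.truncn _.
  rewrite ler_pdivlMr// ltr_pdivrMr// -natr1 => /andP[j1 j2].
  have Md : M%:R * d = 8 * dlen R Q.
    by rewrite ME /d; field; rewrite expf_neq0// pnatr_eq0.
  have jM : (j <= M)%N.
    by rewrite -(ler_nat R) -(ler_pM2r d0) (le_trans j1)// Md p0; lra.
  have pj : p j = p 0 + j%:R * d by rewrite /p !lft_window mul0r addr0.
  have h1 := gam_lip s (p j); have h2 := steps j jM.
  have h3 : j%:R * (d / M%:R) <= d.
    by rewrite mulrCA ler_piMr ?(ltW d0)// ler_pdivrMr// mul1r ler_nat.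
  have h4 : `|s - p j| <= d by rewrite ler_norml pj; lra.
  have h5 : enorm ((s - p j) *: a) <= d * 2.
    by rewrite enormZ ler_pM ?enorm_ge0 ?enorm_slope.
  have -> : gam s - gam (p 0) - (s - p 0) *: a = (gam s - gam (p j)) +
     (gam (p j) - gam (p 0) - (j%:R * d) *: a) - (s - p j) *: a.
    by rewrite pj; apply/rowP => i; rewrite !mxE; ring.
  have := enormB (gam s - gam (p j) + (gam (p j) - gam (p 0) - (j%:R * d) *: a))
    ((s - p j) *: a).
  have := enormD (gam s - gam (p j)) (gam (p j) - gam (p 0) - (j%:R * d) *: a).
  lra.
have near2 s s' : `|s - lft Q| <= 4 * dlen R Q -> `|s' - lft Q| <= 4 * dlen R Q ->
    enorm (gam s - gam s' - (s - s') *: a) <= 10 * d.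
  move=> /near hs /near hs'.
  have -> : gam s - gam s' - (s - s') *: a =
     (gam s - gam (p 0) - (s - p 0) *: a) - (gam s' - gam (p 0) - (s' - p 0) *: a).
    by apply/rowP => i; rewrite !mxE; ring.
  rewrite (le_trans (enormB _ _))//; lra.
have ha : dlen R Q * enorm (slope Q - a) <= 10 * d.
  have := near2 (lft Q + dlen R Q) (lft Q).
  rewrite subrr normr0 addrAC subrr add0r gtr0_norm// => near3.
  have -> : dlen R Q * enorm (slope Q - a) =
      enorm (gam (lft Q + dlen R Q) - gam (lft Q) - dlen R Q *: a).
    rewrite -{1}(gtr0_norm l0) -enormZ scalerBr /slope scalerA mulfV ?gt_eqF//.
    by rewrite scale1r.
  by apply: near3; lra.
move=> s s' hs hs'.
have -> : gam s - gam s' - (s - s') *: slope Q =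
    (gam s - gam s' - (s - s') *: a) - (s - s') *: (slope Q - a).
  by apply/rowP => i; rewrite !mxE; ring.
have h1 := near2 _ _ hs hs'.
have h2 : `|s - s'| <= 8 * dlen R Q by move: hs hs'; rewrite !ler_norml; lra.
have h3 : `|s - s'| * enorm (slope Q - a) <= 80 * d.
  by rewrite (le_trans (ler_wpM2r (enorm_ge0 _) h2))//; lra.
rewrite (le_trans (enormB _ _))// enormZ.
have -> : 90 / 2 ^+ m * dlen R Q = 90 * d by rewrite /d; ring.
lra.
Qed.

Definition nonflat_bound m : R :=
  (8 * 2 ^ m)%N%:R ^+ 4 * 2 ^+ m * (2 ^+ 4 * (\sum_(q < 8) 2 ^+ q * 240)).

(** If [Q] is not flat then one of the boundedly many intervals of its window
    carries a jump of definite size; it lies [m] generations below one of the eight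
    intervals from [shift (- 4) Q] to [shift 3 Q]. *)
Lemma carleson_nonflat m :
  carleson (nonflat_bound m) (weight R (fun Q => ~ flat (90 / 2 ^+ m) Q)).
Proof.
rewrite /nonflat_bound; set M := (8 * 2 ^ m)%N.
have C1 := carleson_gensum m carleson_jump.
have C2 := carleson_sum 8 (fun q => (carleson_shift q C1).1).
have C3 := (carleson_shift 4 C2).2.
apply: (carleson_le _ _ _ C3) => [Q||Q].
- by rewrite /weight; case: asboolP; rewrite // ltW// dlen_gt0.
- by rewrite mulr_ge0 ?exprn_ge0.
rewrite /weight; case: asboolP => [nf|_]; last first.
  rewrite mulr_ge0 ?mulr_ge0 ?exprn_ge0// sumr_ge0// => q _.
  exact: gensum_ge0 jump_ge0 _.
have [j [jM hj]] : exists j, (j < M)%N /\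
    (M%:R ^- 2) ^+ 2 * dlen R (window m Q j) < jump (window m Q j).
  apply: contrapT => h; apply: nf; apply: flat_of_jumps => j jM.
  by rewrite leNgt; apply/negP => ?; apply: h; exists j.
have q8 : (j %/ 2 ^ m < 8)%N by rewrite ltn_divLR ?expn_gt0.
have r2 : (j %% 2 ^ m < 2 ^ m)%N by rewrite ltn_mod expn_gt0.
have := gensum_ge (shift (j %/ 2 ^ m)%:Z (shift (- 4%:Z) Q)) jump_ge0 r2.
have -> : ((shift (j %/ 2 ^ m)%:Z (shift (- 4%:Z) Q)).1 + m%:Z,
    2 ^+ m * (shift (j %/ 2 ^ m)%:Z (shift (- 4%:Z) Q)).2 + (j %% 2 ^ m)%:Z) = window m Q j.
  rewrite /window /shift /=; congr (_, _); rewrite [in RHS](divn_eq j (2 ^ m)).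
  by rewrite PoszD PoszM -[(2 ^ m)%:Z]natz natrX; ring.
set G := gensum jump m; set S := \sum_(q < 8) _ => hG.
have GS : G (shift (j %/ 2 ^ m)%:Z (shift (- 4%:Z) Q)) <= S.
  rewrite /S (bigD1 (Ordinal q8))//= lerDl sumr_ge0// => q _.
  exact: gensum_ge0 jump_ge0 _.
have := le_trans (ltW hj) (le_trans hG GS).
have M0 : 0 < M%:R :> R by rewrite ltr0n muln_gt0 expn_gt0.
rewrite dlen_gen -exprVn -exprM exprVn mulrA ler_pdivrMr ?exprn_gt0//.
rewrite mulrC ler_pdivrMr ?exprn_gt0// => h.
by apply: le_trans h _; rewrite le_eqVlt; apply/orP; left; apply/eqP; ring.
Qed.

End SquareFunction.

(** * Flatness controls the Heisenberg increments *)

Section Lift.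
Variables (R : realType) (n : nat) (Phi : R -> heis R n).
Implicit Types (Q : dyadic).

Definition base s := (Phi s).1.
Definition incr s' s : heis R n := hmul (hinv (Phi s')) (Phi s).

Hypothesis base_lip : forall s s', enorm (base s - base s') <= 2 * `|s - s'|.
Hypothesis vert_lip : forall s s', `|(incr s' s).2| <= 2 * (s - s') ^+ 2.

Lemma hmul_base (p q : heis R n) : (hmul p q).1 = p.1 + q.1.
Proof. by []. Qed.

Lemma hmul_vert (p q : heis R n) :
  (hmul p q).2 = p.2 + q.2 + 2^-1 * symp p.1 q.1.
Proof. by []. Qed.

Lemma incr1 s' s : (incr s' s).1 = base s - base s'.
Proof. by rewrite /= addrC. Qed.

Lemma incrM s' r s : incr s' s = hmul (incr s' r) (incr r s).
Proof. by rewrite /incr -hmulA hmulVKl. Qed.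

(** Cutting [s', s] into [N] pieces, the pieces contribute [O(l ^ 2 / N)] to the
    vertical increment by [vert_lip]; the rest is the symplectic area swept by
    the base curve, which is small since that curve is close to a segment. *)
Lemma vert_small s' s (c : 'rV[R]_(n + n)) D (N : nat) :
  s' <= s -> (0 < N)%N -> enorm c <= 2 ->
  (forall r, s' <= r <= s -> enorm (base r - base s' - (r - s') *: c) <= D) ->
  `|(incr s' s).2| <= 2 * (s - s') ^+ 2 / N%:R + N%:R * (2 * (s - s') * D + D ^+ 2).
Proof.
move=> ss N0 c2 hD; set l := s - s'.
have l0 : 0 <= l by rewrite subr_ge0.
have D0 : 0 <= D by apply: le_trans (enorm_ge0 _) (hD s _); rewrite ss lexx.
have N0R : 0 < N%:R :> R by rewrite ltr0n.
pose q i := s' + i%:R * (l / N%:R).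
have step0 : 0 <= l / N%:R by rewrite divr_ge0// ltW.
have qS i : q i.+1 = q i + l / N%:R by rewrite /q -natr1; ring.
have qN : q N = s by rewrite /q mulrC divfK ?gt_eqF// /l addrC subrK.
have ql i : (i <= N)%N -> 0 <= i%:R * (l / N%:R) <= l.
  move=> iN; rewrite mulr_ge0//= mulrCA ler_piMr// ler_pdivrMr// mul1r ler_nat//.
have qI i : (i <= N)%N -> s' <= q i <= s.
  by move=> /ql; rewrite /q /l; lra.
pose E i := base (q i) - base s' - (q i - s') *: c.
have ED i : (i <= N)%N -> enorm (E i) <= D by move=> /qI /hD.
have XE i : (incr s' (q i)).1 = (q i - s') *: c + E i.
  by rewrite incr1 /E [RHS]addrC subrK.
suff main i : (i <= N)%N -> `|(incr s' (q i)).2| <=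
    i%:R * (2 * (l / N%:R) ^+ 2 + (2 * l * D + D ^+ 2)).
  have := main N (leqnn N); rewrite qN => h; apply: le_trans h _.
  rewrite mulrDr lerD2r le_eqVlt; apply/orP; left; apply/eqP.
  by field; rewrite gt_eqF.
elim: i => [|i IH] iN.
  by rewrite /q mul0r addr0 /incr hmulVh /= normr0 mul0r.
have iN' := ltnW iN.
rewrite (incrM s' (q i)) -natr1 mulrDl mul1r.
have hs : `|symp (incr s' (q i)).1 (incr (q i) (q i.+1)).1| <= 4 * l * D + D ^+ 2.
  have -> : symp (incr s' (q i)).1 (incr (q i) (q i.+1)).1 =
     symp (incr s' (q i)).1 (incr s' (q i.+1)).1.
    by rewrite (incrM s' (q i) (q i.+1)) hmul_base sympDr sympxx add0r.
  rewrite !XE; set a := q i - s'; set b := q i.+1 - s'.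
  have [a0 al] : 0 <= a /\ a <= l by apply/andP; have := qI i iN'; rewrite /a /l; lra.
  have [b0 bl] : 0 <= b /\ b <= l by apply/andP; have := qI _ iN; rewrite /b /l; lra.
  have h1 := ED i iN'; have h2 := ED _ iN.
  move: (E i) (E i.+1) h1 h2 => e e' h1 h2.
  have -> : symp (a *: c + e) (b *: c + e') = a * symp c e' - b * symp c e + symp e e'.
    by rewrite !sympE (sympC e c); ring.
  have k1 : `|symp e e'| <= D ^+ 2.
    by rewrite (le_trans (symp_le _ _))// expr2 ler_pM ?enorm_ge0.
  have k2 : `|a * symp c e'| <= l * (2 * D).
    by rewrite normrM ger0_norm// ler_pM// (le_trans (symp_le _ _))// ler_pM ?enorm_ge0.
  have k3 : `|b * symp c e| <= l * (2 * D).
    by rewrite normrM ger0_norm// ler_pM// (le_trans (symp_le _ _))// ler_pM ?enorm_ge0.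
  move: k1 k2 k3; rewrite !ler_norml; lra.
have hv : `|(incr (q i) (q i.+1)).2| <= 2 * (l / N%:R) ^+ 2.
  by rewrite (le_trans (vert_lip _ _))// qS addrAC subrr add0r.
have D2 : 0 <= D ^+ 2 by rewrite sqr_ge0.
move: (IH iN') hs hv; rewrite hmul_vert !ler_norml; lra.
Qed.

(** Over a flat interval whose slope is close to [c], increments of the curve lie
    in a narrow cone around the direction of [c].  The hypotheses on [N] and [b]
    balance the two terms of [vert_small]: [N] is large compared with [1 / k], and
    [b] is small compared with [k / N]. *)
Lemma cone_of_flat k b e N Q c s s' :
  0 < k <= 1 -> (0 < N)%N -> 16 <= k * N%:R -> 0 <= b -> 24 * N%:R * b <= k ->
  flat base e Q -> enorm (slope base Q - c) <= b -> 1 <= enorm c ->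
  `|s - lft R Q| <= 4 * dlen R Q -> `|s' - lft R Q| <= 4 * dlen R Q ->
  s' <= s -> e * dlen R Q <= b * (s - s') ->
  cone ((enorm c)^-1 *: c) k (incr s' s).
Proof.
move=> /andP[k0 k1] N0 kN b0 bk fQ cQ c1 sQ sQ' ss eQ.
set l := s - s' in eQ *; have l0 : 0 <= l by rewrite subr_ge0.
have N1 : 1 <= N%:R :> R by rewrite ler1n.
have Nb : b <= N%:R * b by rewrite ler_peMl.
set err := base s - base s' - l *: c.
have herr : enorm err <= 2 * b * l.
  have -> : err = (base s - base s' - l *: slope base Q) + l *: (slope base Q - c).
    by apply/rowP => i; rewrite !mxE; ring.
  rewrite (le_trans (enormD _ _))// enormZ ger0_norm//.
  have := fQ s s' sQ sQ'; have := ler_wpM2l l0 cQ; rewrite -/l; lra.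
have hv : `|(incr s' s).2| <= 2 * l ^+ 2 / N%:R + N%:R * (2 * l * (b * l) + (b * l) ^+ 2).
  apply: (vert_small (c := slope base Q)) => //; first exact: enorm_slope.
  move=> r /andP[r1 r2]; rewrite -/l (le_trans (fQ r s' _ sQ'))//.
  by move: sQ sQ'; rewrite !ler_norml; lra.
set r := enorm c in c1 *; set u := r^-1 *: c.
have r0 : 0 < r by lra.
have u1 : enorm u = 1 by rewrite enormZ ger0_norm ?invr_ge0 ?(ltW r0)// mulVf ?gt_eqF.
have cE : c = r *: u by rewrite scalerA mulfV ?gt_eqF// scale1r.
have uu := enorm1_dot u1.
have xE : (incr s' s).1 = (l * r) *: u + err.
  by rewrite incr1 /err -scalerA -cE [RHS]addrC subrK.
clearbody u err.
have hd := dot_abs err u; rewrite u1 mulr1 in hd.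
set m := dot (incr s' s).1 u.
have mE : m = l * r + dot err u by rewrite /m xE !dotE uu mulr1.
have lr : l <= l * r by rewrite ler_peMr.
have bl : 24 * (b * l) <= l.
  have : 24 * b <= 1 by lra.
  by move=> /(ler_wpM2r l0); lra.
have ml : l <= 2 * m by move: hd herr; rewrite mE ler_norml; lra.
have m0 : 0 <= m by lra.
have b1 : 24 * b <= k by lra.
have bl0 : 0 <= b * l by rewrite mulr_ge0.
have bm : b * l <= 2 * (b * m) by have := ler_wpM2l b0 ml; lra.
rewrite /cone -/m; split => //.
- have -> : (incr s' s).1 - m *: u = err - dot err u *: u.
    by rewrite xE mE; apply/rowP => i; rewrite !mxE; ring.
  rewrite (le_trans (enormB _ _))// enormZ u1 mulr1.
  have := ler_wpM2r m0 b1; lra.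
- have l2 : l ^+ 2 <= 4 * m ^+ 2.
    have -> : 4 * m ^+ 2 = (2 * m) ^+ 2 by ring.
    by rewrite ler_sqr// nnegrE; lra.
  have N0R : 0 < N%:R :> R by lra.
  have i16 : 16 / N%:R <= k by rewrite ler_pdivrMr.
  have e1 : 2 * l ^+ 2 / N%:R = 16 / N%:R * (l ^+ 2 / 8) by field; lra.
  have l20 : 0 <= l ^+ 2 by rewrite sqr_ge0.
  have h1 : 2 * l ^+ 2 / N%:R <= k * (l ^+ 2 / 8).
    by rewrite e1 ler_wpM2r//; lra.
  have h2 : N%:R * (2 * l * (b * l) + (b * l) ^+ 2) <= k * (l ^+ 2 / 8).
    have -> : N%:R * (2 * l * (b * l) + (b * l) ^+ 2) = (N%:R * b) * (l ^+ 2 * (2 + b)).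
      by ring.
    have h3 : N%:R * b <= k / 24 by lra.
    have h4 : l ^+ 2 * (2 + b) <= l ^+ 2 * 3 by rewrite ler_wpM2l//; lra.
    have h5 : 0 <= N%:R * b by rewrite mulr_ge0// ltW.
    have h6 : 0 <= l ^+ 2 * (2 + b) by rewrite mulr_ge0// addr_ge0.
    have := ler_pM h5 h6 h3 h4; lra.
  have := ler_wpM2l (ltW k0) l2; lra.
Qed.

End Lift.

(** * Ancestors of dyadic intervals *)

Section DyadicTree.
Variable R : realType.
Implicit Types (Q P : dyadic) (b : bool).

Definition parent Q : dyadic := (Q.1 - 1, (Q.2 %/ 2)%Z).

Lemma childK b Q : parent (child b Q) = Q.
Proof.
case: Q => j k; rewrite /parent /child /= addrK; congr pair.
by rewrite mulrC divzMDl// divz_small ?addr0//; case: b.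
Qed.

Lemma parentK Q : {b | child b (parent Q) = Q}.
Proof.
case: Q => j k; exists ((k %% 2)%Z == 1); rewrite /child /= subrK; congr pair.
have k2 : (k %% 2)%Z < 2 by rewrite ltz_pmod.
have k0 : 0 <= (k %% 2)%Z by rewrite modz_ge0.
rewrite [RHS](divz_eq k 2) mulrC; congr (_ + _).
by case: eqP => /=; move: k0 k2; case: (k %% 2)%Z => // -[|[|?]].
Qed.

Lemma dlen_parent Q : dlen R (parent Q) = 2 * dlen R Q.
Proof.
by have [b <-] := parentK Q; rewrite childK dlen_child mulrC divfK ?pnatr_eq0.
Qed.

Lemma dset_sub_child b Q : dsub R (child b Q) Q.
Proof.
move=> s /dset_itvE; rewrite dlen_child /= => /andP[h1 h2]; apply/dset_itvE.
have l0 := dlen_gt0 R Q.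
move: h1 h2; rewrite !intrD !intrM; case: b => /=; rewrite ?addr0 => h1 h2.
  by apply/andP; split; lra.
by apply/andP; split; lra.
Qed.

Lemma dsub_parent Q : dsub R Q (parent Q).
Proof. by have [b {1}<-] := parentK Q; exact: dset_sub_child. Qed.

Lemma iter_parent m Q Q' : Q.1 = Q'.1 + m%:Z ->
  Q'.2 * 2 ^+ m <= Q.2 -> Q.2 < (Q'.2 + 1) * 2 ^+ m -> iter m parent Q = Q'.
Proof.
elim: m Q => [|m IH] [j k] /=.
  case: Q' => j' k' /=; rewrite addr0 !mulr1 ltzD1 => -> h1 h2; congr pair.
  by apply/eqP; rewrite eq_le h1 h2.
move=> jE h1 h2; rewrite -iterS iterSr; apply: IH => /=.
- by rewrite jE intS; ring.
- by rewrite lez_divRL// -mulrA -exprSr.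
- by rewrite ltz_divLR// -mulrA -exprSr.
Qed.

Lemma dsub_iter Q Q' : dsub R Q Q' -> exists m : nat, iter m parent Q = Q'.
Proof.
move=> /dsubP[h1 h2].
have ll : dlen R Q <= dlen R Q' by move: h1 h2; rewrite !intrD; lra.
have jj : Q'.1 <= Q.1.
  by move: ll; rewrite /dlen ler_eXz2l ?ltr1n// lerN2.
have [m mE] : exists m : nat, Q.1 = Q'.1 + m%:Z.
  by exists `|Q.1 - Q'.1|%N; rewrite gez0_abs ?subr_ge0// [RHS]addrC subrK.
have lE : dlen R Q = dlen R Q' / 2 ^+ m.
  by rewrite /dlen mE opprD expfzDr ?pnatr_eq0// -exprnN.
have l0 := dlen_gt0 R Q'; have p0 : 0 < 2 ^+ m :> R by rewrite exprn_gt0.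
exists m; apply: iter_parent => //.
  rewrite -(ler_int R) intrM rmorphXn /= -ler_pdivlMr// -(ler_pM2r l0).
  by move: h1; rewrite lE mulrAC -mulrA [dlen _ _ * _]mulrC mulrA.
rewrite -lezD1 -(ler_int R) intrM rmorphXn /= -(ler_pM2r l0).
rewrite -(@ler_pM2r _ (2 ^+ m)^-1) ?invr_gt0//.
move: h2; rewrite lE; congr (_ <= _); first by ring.
by field; rewrite gt_eqF.
Qed.

Lemma dsub_gen Q Q' : dsub R Q Q' -> Q'.1 <= Q.1.
Proof.
move=> /dsub_iter[m <-]; elim: m => //= m IH; apply: le_trans IH.
by rewrite gerDl.
Qed.

Lemma dsub_trans Q P Q' : dsub R Q P -> dsub R P Q' -> dsub R Q Q'.
Proof. by move=> h1 h2; apply: subset_trans h1 h2. Qed.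

Lemma dsub_ancestor m Q : dsub R Q (iter m parent Q).
Proof. by elim: m => //= m IH; apply: dsub_trans IH (@dsub_parent _). Qed.

End DyadicTree.

(** * Forests from a stopping rule *)

Section Forest.
Variables (R : realType) (good : dyadic -> Prop) (keep : dyadic -> dyadic -> Prop).
Hypothesis good_off0 : forall Q, good Q -> Q.2 != 0 /\ Q.2 != -1.
Hypothesis keep_good : forall t P b, keep t P -> good (child b P).
Implicit Types (Q P t : dyadic) (b : bool).

Definition cont t P : Prop := good P /\ keep t P.

(** The top of the tree through [Q] is found by climbing to the parent as long as
    the rule keeps its children.  The climb ends because a good parent has an index
    strictly smaller in absolute value; hence the index serves as fuel. *)
Fixpoint top_fuel (N : nat) Q : dyadic :=
  if N is N'.+1 then
    let t := top_fuel N' (parent Q) in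
    if `[< cont t (parent Q) >] then t else Q
  else Q.

Definition top_of Q : dyadic := top_fuel `|Q.2| Q.

(** Only the indices 0 and -1 are fixed by halving, and they are not good. *)
Lemma parent_index Q : good (parent Q) -> (`|(parent Q).2| < `|Q.2|)%N.
Proof.
move=> /good_off0[]; case: Q => j k /=.
have := divz_eq k 2; have := modz_ge0 k (isT : 2 != 0 :> int).
have := ltz_pmod k (isT : 0 < 2 :> int); lia.
Qed.

Lemma parent_index_le Q : (`|(parent Q).2| <= `|Q.2|)%N.
Proof.
case: Q => j k /=.
have := divz_eq k 2; have := modz_ge0 k (isT : 2 != 0 :> int).
have := ltz_pmod k (isT : 0 < 2 :> int); lia.
Qed.

Lemma top_fuelS N Q : (`|Q.2| <= N)%N -> top_fuel N.+1 Q = top_fuel N Q.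
Proof.
elim: N Q => [|N IH] Q QN.
  rewrite /=; case: asboolP => // -[/parent_index].
  by move: QN; rewrite leqn0 => /eqP ->.
rewrite [LHS]/= [RHS]/=; have [gP|nP] := pselect (good (parent Q)).
  rewrite -/(top_fuel N.+1 (parent Q)) IH//.
  by rewrite -ltnS (leq_trans (parent_index gP)).
by do 2!case: asboolP => [[/nP]//|_].
Qed.

Lemma top_fuel_ge N Q : (`|Q.2| <= N)%N -> top_fuel N Q = top_of Q.
Proof.
rewrite /top_of => /subnKC <-; elim: (N - _)%N => [|m IH]; first by rewrite addn0.
by rewrite addnS top_fuelS// leq_addr.
Qed.

Lemma top_ofE Q : top_of Q =
  if `[< cont (top_of (parent Q)) (parent Q) >] then top_of (parent Q) else Q.
Proof.
rewrite -(top_fuel_ge (leqnSn _)) /= top_fuel_ge//; exact: parent_index_le.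
Qed.

Lemma top_of_child b P :
  top_of (child b P) = if `[< cont (top_of P) P >] then top_of P else child b P.
Proof. by rewrite top_ofE childK. Qed.

Lemma good_ind (X : dyadic -> Prop) :
  (forall Q, (good (parent Q) -> X (parent Q)) -> X Q) -> forall Q, X Q.
Proof.
move=> h Q; have [N] := ubnP `|Q.2|%N; elim: N Q => [//|N IH] Q QN.
by apply: h => gP; apply: IH; apply: leq_trans (parent_index gP) _.
Qed.

Lemma dsub_top_of Q : dsub R Q (top_of Q).
Proof.
elim/good_ind: Q => Q IH; rewrite top_ofE; case: asboolP => [[gP _]|_]; last exact: subset_refl.
exact: dsub_trans (@dsub_parent R Q) (IH gP).
Qed.

Lemma top_of_good Q : good Q -> good (top_of Q).
Proof.
elim/good_ind: Q => Q IH gQ; rewrite top_ofE; case: asboolP => // -[gP _].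
exact: IH.
Qed.

Lemma top_of_idem Q : top_of (top_of Q) = top_of Q.
Proof.
elim/good_ind: Q => Q IH; rewrite [in RHS]top_ofE [in LHS](top_ofE Q).
case: asboolP => [[gP _]|n]; first exact: IH.
by rewrite top_ofE; case: asboolP.
Qed.

Definition top_set : set dyadic := [set t | good t /\ top_of t = t].
Definition tree_of t : set dyadic := [set Q | good Q /\ top_of Q = t].
Definition forest : set (set dyadic) := [set tree_of t | t in top_set].

Lemma tree_of_top t : top_set t -> top R (tree_of t) = t.
Proof.
by move=> ht; apply: topE; split=> // Q [_ <-]; exact: dsub_top_of.
Qed.

Lemma child_neq_above b P Q : dsub R P Q -> child b P <> Q.
Proof. by move=> /[swap] <- /dsub_gen /=; rewrite gerDl. Qed.

Lemma tree_of_is_tree t : top_set t -> is_tree R (tree_of t).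
Proof.
move=> ht; split.
- by exists t; split=> // Q [_ <-]; exact: dsub_top_of.
- move=> Q Q' + /dsub_iter[m]; rewrite (tree_of_top ht).
  elim: m Q => [|m IH] Q TQ; first by move=> /= <-.
  rewrite iterSr => EQ' Q't; apply: (IH _ _ EQ' Q't).
  case: TQ => gQ; rewrite top_ofE; case: asboolP => [[gP _] rP|_ Qt]; first by split.
  have : dsub R (parent Q) Q.
    by rewrite {2}Qt; apply: dsub_trans Q't; rewrite -EQ'; exact: dsub_ancestor.
  by move=> /dsub_gen /=; rewrite lerBrDr gerDl.
- move=> Q [gQ rQ]; have Qt : dsub R Q t by rewrite -rQ; exact: dsub_top_of.
  have [kQ|nQ] := pselect (cont (top_of Q) Q); [left|right].
    have Tc b : tree_of t (child b Q).
      split; first exact: keep_good kQ.2.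
      by rewrite top_of_child asboolT.
    by split.
  have Tc b : ~ tree_of t (child b Q).
    by move=> [_]; rewrite top_of_child asboolF//; exact: child_neq_above Qt.
  by split.
Qed.

Lemma forest_is_forest : is_forest R forest [set Q | good Q].
Proof.
split.
- by move=> _ [t ht <-]; exact: tree_of_is_tree.
- move=> _ _ [t ht <-] [t' ht' <-] [Q [[_ h] [_ h']]] /=.
  by congr tree_of; rewrite -h -h'.
- rewrite eqEsubset; split=> [Q [_ [t _ <-]] [] //|Q gQ].
  exists (tree_of (top_of Q)) => //; exists (top_of Q) => //.
  by split; [exact: top_of_good|exact: top_of_idem].
Qed.

End Forest.

(** * From weights to packing conditions *)

Section Packing.
Variable R : realType.
Implicit Types (f : dyadic -> R) (Q P x : dyadic) (D : set dyadic).

Lemma le_treesum_descendant f N m x Q : nneg f -> (m < N)%N ->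
  iter m parent x = Q -> f x <= treesum f N Q.
Proof.
move=> f0; elim: m N Q => [|m IH] [//|N] Q /= mN.
  by move=> ->; rewrite lerDl addr_ge0 ?treesum_ge0.
move=> yQ; have [b] := parentK (iter m parent x); rewrite yQ => E.
apply: le_trans (IH N (child b Q) mN (esym E)) _.
apply: le_trans (_ : treesum f N (lchild Q) + treesum f N (rchild Q) <= _).
  case: b {E}; first by rewrite -[leLHS]add0r lerD2r treesum_ge0.
  by rewrite -[leLHS]addr0 lerD2l treesum_ge0.
by rewrite lerDr.
Qed.

Lemma sum_le_treesum f (r : seq dyadic) N Q : nneg f -> uniq r ->
  (forall x, x \in r -> exists2 m, (m < N)%N & iter m parent x = Q) ->
  \sum_(x <- r) f x <= treesum f N Q.
Proof.
move=> f0 ur hr.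
have h P : (if P \in r then f P else 0) <= f P by case: ifP.
apply: le_trans (le_treesum N Q h).
elim: r ur hr {h} => [|x r IH] /=.
  by move=> _ _; rewrite big_nil treesum_ge0.
move=> /andP[xr ur] hr; rewrite big_cons.
have -> : (fun P => if P \in x :: r then f P else 0) =
    (fun P => (if P == x then f P else 0) + (if P \in r then f P else 0)).
  apply/funext => P; rewrite inE; case: eqP => [->|_] /=; last by rewrite add0r.
  by rewrite (negbTE xr) addr0.
rewrite treesumD lerD ?IH//; last by move=> y yr; apply: hr; rewrite inE yr orbT.
have [m mN mx] := hr x (mem_head _ _).
have := @le_treesum_descendant (fun P => if P == x then f P else 0) N m x Q.
by rewrite eqxx; apply=> // P; case: ifP.
Qed.

Lemma carleson_packing_of C D : carleson C (weight R D) ->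
  carleson_packing C D id.
Proof.
move=> [w0 wC] Q0; apply: ub_ereal_sup => _ /= [A [fA AD] <-].
rewrite fsbig_finite//= sumEFin lee_fin.
have rP x : x \in fset_set A -> D x /\ exists m, iter m parent x = Q0.
  by rewrite in_fset_set// => /set_mem /AD[Dx /dsub_iter].
have [N hN] : exists N, forall x, x \in (fset_set A : seq _) ->
    exists2 m, (m < N)%N & iter m parent x = Q0.
  have : forall x, x \in (fset_set A : seq _) -> exists m, iter m parent x = Q0.
    by move=> x /rP[].
  elim: (fset_set A : seq _) => [|x r IH] h; first by exists 0.
  have [N hN] := IH (fun y yr => h y (@mem_behead _ (x :: r) y yr)).
  have [m mx] := h x (mem_head _ _).
  exists (maxn N m.+1) => y; rewrite inE => /orP[/eqP ->|/hN[k kN ky]].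
    by exists m => //; rewrite leq_max leqnn orbT.
  by exists k => //; rewrite leq_max kN.
apply: le_trans (wC N Q0).
have := sum_le_treesum w0 (fset_uniq _) hN; congr (_ <= _).
apply: eq_big_seq => x /rP[Dx _]; by rewrite /weight asboolT.
Qed.

Lemma forest_packing C (good : dyadic -> Prop) (keep : dyadic -> dyadic -> Prop) :
  (forall Q, good Q -> Q.2 != 0 /\ Q.2 != -1) ->
  carleson C (weight R (top_set good keep)) ->
  carleson_packing C (forest good keep) (top R).
Proof.
move=> off0 /carleson_packing_of h Q0; apply: le_trans (h Q0).
rewrite (reindex_esum [set t | top_set good keep t /\ dsub R t Q0] _
    (tree_of good keep)) /=; last first.
  split=> [t [ht tQ]|t t' /set_mem[ht _] /set_mem[ht' _]|_ [[t ht <-]]] /=.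
  - by split; [exists t|rewrite (tree_of_top _ off0)].
  - by move=> /(congr1 (top R)); rewrite !(tree_of_top _ off0)//.
  - by rewrite (tree_of_top _ off0)// => tQ; exists t.
apply: le_esum => t [ht _]; rewrite (tree_of_top _ off0)//.
Qed.

End Packing.

(** * The stopping rule and the packing of the tops *)

Section Stopping.
Variables (R : realType) (n : nat) (gam : R -> 'rV[R]_(n + n)) (m : nat) (d : R).
Hypothesis gam_lip : forall s s', enorm (gam s - gam s') <= 2 * `|s - s'|.
Implicit Types (Q P t : dyadic) (b : bool).

Local Notation slope := (slope gam).

(** The intervals with an endpoint at 0 are excluded because a tree must have a top:
    they are few, and every other interval has only finitely many ancestors before
    meeting one of them. *)
Definition good Q : Prop := [/\ flat gam (90 / 2 ^+ m) Q, Q.2 != 0 & Q.2 != -1].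

(** The rule is imposed on both children at once, since a tree contains both or
    neither. *)
Definition keep t P : Prop :=
  forall b, good (child b P) /\ enorm (slope (child b P) - slope t) <= d.

Lemma good_off0 Q : good Q -> Q.2 != 0 /\ Q.2 != -1.
Proof. by case. Qed.

Lemma keep_good t P b : keep t P -> good (child b P).
Proof. by move=> /(_ b)[]. Qed.

(** Each of these intervals has exactly one child of the same kind, so their lengths
    form a geometric series. *)
Lemma carleson_axis :
  carleson 2 (weight R (fun Q => Q.2 = 0 \/ Q.2 = -1)).
Proof.
apply: (carleson_potential (U := fun Q => 2 * weight R (fun Q => Q.2 = 0 \/ Q.2 = -1) Q)).
- exact: weight_ge0.
- by move=> Q; rewrite mulr_ge0// weight_ge0.
- move=> [j k]; have l0 := dlen_gt0 R (j, k).
  rewrite /weight !dlen_child /lchild /rchild /child /=.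
  by do 3!case: asboolP => ?; try lra; exfalso; lia.
- by move=> Q; rewrite ler_pM2l// weight_le.
Qed.

Lemma carleson_bad : carleson (nonflat_bound R m + 2) (weight R (fun Q => ~ good Q)).
Proof.
have := carlesonD (carleson_nonflat gam_lip m) carleson_axis.
move=> /(carleson_le (C' := 1)); rewrite mul1r; apply.
- exact: weight_ge0.
- exact: ler01.
move=> Q; rewrite mul1r.
rewrite {1}/weight; case: asboolP => nQ; last by rewrite addr_ge0 ?weight_ge0.
have [fQ|nf] := pselect (flat gam (90 / 2 ^+ m) Q); last first.
  by rewrite -[leLHS]addr0 lerD ?weight_ge0// /weight asboolT.
rewrite -[leLHS]add0r lerD ?weight_ge0// /weight asboolT//.
have [|k0] := eqVneq Q.2 0; [by left|right].
by have [//|k1] := eqVneq Q.2 (-1); case: nQ.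
Qed.

Hypothesis d0 : 0 < d.

Local Notation tp := (top_of good keep).

Lemma top_of_child_keep b P : good P -> keep (tp P) P -> tp (child b P) = tp P.
Proof. by move=> gP kP; rewrite (top_of_child keep good_off0) asboolT. Qed.

Lemma top_of_child_stop b P : ~ (good P /\ keep (tp P) P) -> tp (child b P) = child b P.
Proof. by move=> h; rewrite (top_of_child keep good_off0) asboolF. Qed.

Lemma slope_near_top Q : good Q -> enorm (slope Q - slope (tp Q)) <= d.
Proof.
move=> gQ; have [b E] := parentK Q.
have [[gP kP]|n0] := pselect (good (parent Q) /\ keep (tp (parent Q)) (parent Q)).
  have := (kP b).2; rewrite -(top_of_child_keep b gP kP) E.
  exact.
by rewrite -E top_of_child_stop// subrr enorm0 ltW.
Qed.

Definition drifted P : Prop :=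
  good P /\ exists b, d < enorm (slope (child b P) - slope (tp P)).

Definition drift Q : R :=
  if `[< good Q >] then
    let w := slope Q - slope (tp Q) in dot w w * dlen R Q else 0.

Lemma drift_ge0 : nneg drift.
Proof.
move=> Q; rewrite /drift; case: asboolP => // _.
by rewrite mulr_ge0 ?dotxx_ge0// ltW// dlen_gt0.
Qed.

Lemma drift_top Q : tp Q = Q -> drift Q = 0.
Proof. by rewrite /drift => ->; case: asboolP => // _; rewrite subrr dot0l mul0r. Qed.

(** From [P] to its children the squared distance to the slope at the top, weighted
    by length, grows exactly by the energy [haar P].  When a large drift ends the
    tree, this amount is reset to 0 and pays for the tops of the new trees. *)
Lemma drift_step P :
  d ^+ 2 / 2 * weight R drifted P + (drift (lchild P) + drift (rchild P)) <=
  drift P + haar gam P.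
Proof.
have l0 := dlen_gt0 R P; have h0 := haar_ge0 gam P; have D0 := drift_ge0 P.
have d20 : 0 <= d ^+ 2 / 2 by rewrite divr_ge0// sqr_ge0.
have [gP|nP] := pselect (good P); last first.
  have st b : drift (child b P) = 0 by apply/drift_top/top_of_child_stop => -[].
  by rewrite !st /weight asboolF ?mulr0 ?addr0 ?addr_ge0// => -[].
have E : drift P + haar gam P =
    (let w := slope (lchild P) - slope (tp P) in dot w w * (dlen R P / 2)) +
    (let w := slope (rchild P) - slope (tp P) in dot w w * (dlen R P / 2)).
  rewrite /drift asboolT// /haar (slope_avg gam P).
  move: (slope (lchild P)) (slope (rchild P)) (slope (tp P)) => A B C /=.
  by rewrite !dotE (dotC B A) (dotC C A) (dotC C B); field.
have [kP|nk] := pselect (keep (tp P) P).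
  have ww b : drift (child b P) =
      let w := slope (child b P) - slope (tp P) in dot w w * (dlen R P / 2).
    rewrite /drift asboolT; last exact: keep_good kP.
    by rewrite top_of_child_keep// dlen_child.
  rewrite !ww E /weight asboolF ?mulr0 ?add0r// => -[_ [b]].
  by rewrite ltNge (kP b).2.
have st b : drift (child b P) = 0 by apply/drift_top/top_of_child_stop => -[].
rewrite !st !addr0.
rewrite /weight; case: asboolP => [[_ [b hb]]|_]; last by rewrite mulr0 addr_ge0.
rewrite E.
have q b' : 0 <= dot (slope (child b' P) - slope (tp P)) (slope (child b' P) - slope (tp P)).
  exact: dotxx_ge0.
have : d ^+ 2 <= dot (slope (child b P) - slope (tp P)) (slope (child b P) - slope (tp P)).
  by rewrite -enorm_sqr ler_sqr ?nnegrE ?enorm_ge0 ?ltW.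
move=> /(ler_wpM2r (ltW l0)); have := mulr_ge0 (q false) (ltW l0).
have := mulr_ge0 (q true) (ltW l0); rewrite /= -/(lchild P) -/(rchild P).
case: b {hb}; rewrite -/(lchild P) -/(rchild P); lra.
Qed.

Lemma carleson_drifted : carleson (40 / d ^+ 2) (weight R drifted).
Proof.
have d2 : 0 < d ^+ 2 / 2 by rewrite divr_gt0// exprn_gt0.
have h : carleson 20 (fun P => d ^+ 2 / 2 * weight R drifted P).
  apply: (carleson_potential (U := fun Q => defect gam Q + drift Q)).
  - by move=> Q; rewrite mulr_ge0 ?weight_ge0 ?(ltW d2).
  - by move=> Q; rewrite addr_ge0 ?drift_ge0 ?defect_ge0.
  - by move=> P; have := drift_step P; rewrite (defect_haar gam P); lra.
  - move=> P; have := defect_le gam P; have l0 := dlen_gt0 R P.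
    suff : drift P <= 16 * dlen R P by lra.
    rewrite /drift; case: asboolP => _; last by rewrite mulr_ge0// ltW.
    rewrite ler_pM2r// [leRHS](_ : _ = 4 ^+ 2); last by ring.
    rewrite -enorm_le// (le_trans (enormB _ _))//.
    have := enorm_slope gam_lip P; have := enorm_slope gam_lip (tp P); lra.
have -> : 40 / d ^+ 2 = (d ^+ 2 / 2)^-1 * 20 by field; rewrite gt_eqF.
apply: carleson_le h => [||Q]; first exact: weight_ge0.
  by rewrite invr_ge0 ltW.
by rewrite mulKf// gt_eqF.
Qed.

(** A tree starts at [child b P] only if [P] is bad, or a child of [P] is bad, or the
    slope has drifted at [P]. *)
Lemma carleson_tops :
  carleson (1 + (2 * (nonflat_bound R m + 2) + 40 / d ^+ 2))
    (weight R (top_set good keep)).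
Proof.
have [b0 bC] := carlesonD (carlesonD carleson_bad (carleson_gensum 1 carleson_bad))
  carleson_drifted.
split=> [|N Q]; first exact: weight_ge0.
apply: le_trans (treesum_leS N Q (weight_ge0 R _)) _.
rewrite treesumS mulrDl mul1r lerD ?weight_le//.
apply: le_trans (le_treesum N Q _) _; last first.
  apply: le_trans (bC N Q) _; rewrite le_eqVlt; apply/orP; left; apply/eqP; ring.
move=> P; have l0 := dlen_gt0 R P; rewrite /gensum /lchild /rchild.
have w0 X Q' : 0 <= weight R X Q' by exact: weight_ge0.
have wT (X : dyadic -> Prop) Q' : X Q' -> weight R X Q' = dlen R Q'.
  by move=> h; rewrite /weight asboolT.
have wF (X : dyadic -> Prop) Q' : ~ X Q' -> weight R X Q' = 0.
  by move=> h; rewrite /weight asboolF.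
have tl b : weight R (top_set good keep) (child b P) <= dlen R P / 2.
  by rewrite (le_trans (weight_le _ _ _))// dlen_child.
have tb b : ~ good (child b P) -> weight R (top_set good keep) (child b P) = 0.
  by move=> nb; apply: wF => -[].
have cl b : ~ good (child b P) ->
    weight R (fun Q => ~ good Q) (child b P) = dlen R P / 2.
  by move=> nb; rewrite wT// dlen_child.
have := tl false; have := tl true.
have := w0 (fun Q => ~ good Q) P; have := w0 drifted P.
have := w0 (fun Q => ~ good Q) (child false P).
have := w0 (fun Q => ~ good Q) (child true P).
have [gP|nP] := pselect (good P); last by rewrite [weight R (fun Q => ~ good Q) P]wT//; lra.
have [gl|nl] := pselect (good (child false P)); last by rewrite (tb false nl) (cl false nl); lra.
have [gr|nr] := pselect (good (child true P)); last by rewrite (tb true nr) (cl true nr); lra.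
have [kP|nk] := pselect (keep (tp P) P).
  have tz b : weight R (top_set good keep) (child b P) = 0.
    apply: wF => -[_]; rewrite top_of_child_keep// => /esym.
    exact: child_neq_above (@dsub_top_of R _ keep good_off0 P).
  by rewrite (tz false) (tz true); lra.
suff dP : drifted P by rewrite [weight R drifted P]wT//; lra.
split=> //; apply: contrapT => nd; apply: nk => b; split; first by case: b.
by rewrite leNgt; apply/negP => h; apply: nd; exists b.
Qed.

End Stopping.

(** * A graph through the curve at the scales of a tree *)

Section LimitClosed.
Variable R : realType.
Implicit Type A : set R.

Definition limit_closed A : Prop :=
  forall s, (forall r, 0 < r -> exists2 e, A e & `|s - e| <= r) -> A s.

Lemma limit_closed_max A (a M : R) : limit_closed A -> A a ->
  (forall x, A x -> x <= M) -> exists2 x, A x & forall y, A y -> y <= x.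
Proof.
move=> cA Aa AM; have sA : has_sup A by split; [exists a|exists M => x /AM].
exists (sup A); last by move=> y Ay; exact: sup_upper_bound sA _ Ay.
apply: cA => r r0; have [e Ae h] := sup_adherent r0 sA; exists e => //.
have := sup_upper_bound sA Ae; rewrite ler_norml; lra.
Qed.

Lemma limit_closed_min A (a M : R) : limit_closed A -> A a ->
  (forall x, A x -> M <= x) -> exists2 x, A x & forall y, A y -> x <= y.
Proof.
move=> cA Aa AM.
have [|||x Ax xm] := @limit_closed_max [set x | A (- x)] (- a) (- M).
- move=> s h; apply: cA => r /h[e Ae se]; exists (- e) => //.
  by rewrite -opprD normrN.
- by rewrite /= opprK.
- by move=> x /AM; rewrite lerNr.
by exists (- x) => // y Ay; rewrite lerNl; apply: xm; rewrite /= opprK.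
Qed.

End LimitClosed.

Section TreeCurve.
Variables (R : realType) (n : nat) (Phi : R -> heis R n).
Variables (T : set dyadic) (t : dyadic) (K : nat) (u : 'rV[R]_(n + n)) (k : R).
Hypotheses (Tt : T t) (Tsub : forall Q, T Q -> dsub R Q t).
Hypothesis Tup : forall Q P, T Q -> dsub R Q P -> dsub R P t -> T P.
Hypothesis K0 : (0 < K)%N.
Hypothesis Tcone : forall Q s s', T Q ->
  `|s - lft R Q| <= 4 * dlen R Q -> `|s' - lft R Q| <= 4 * dlen R Q ->
  s' <= s -> dlen R Q / 2 ^+ K <= 2 * (s - s') -> prec u k (Phi s') (Phi s).
Implicit Types (Q P : dyadic).

Local Notation grid Q := (dlen R Q / 2 ^+ K).

(** The points at which the approximating graph has to meet the curve: near an
    interval of the tree their mesh is a small fraction of its length. *)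
Definition grid_points : set R := [set e | exists Q, T Q /\
  ((exists i : int, e = i%:~R * grid Q) /\ `|e - lft R Q| <= 2 * dlen R Q)].

(** For infinite trees the grid points accumulate.  The closure is taken so that
    every gap has endpoints at which the curve is interpolated. *)
Definition grid_closure : set R :=
  [set s | forall r, 0 < r -> exists2 e, grid_points e & `|s - e| <= r].

Lemma grid_points_closure : grid_points `<=` grid_closure.
Proof. by move=> e he r r0; exists e => //; rewrite subrr normr0 ltW. Qed.

Lemma grid_gt0 Q : 0 < grid Q.
Proof. by rewrite divr_gt0 ?dlen_gt0 ?exprn_gt0. Qed.

Lemma grid_points_top e : grid_points e -> `|e - lft R t| <= 2 * dlen R t.
Proof.
move=> [Q [TQ [_ h]]]; have /dsubP[] := Tsub TQ.
rewrite -/(lft R Q) -/(lft R t) !intrD !mulrDl -/(lft R Q) -/(lft R t).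
have := dlen_gt0 R Q; move: h; rewrite !ler_norml; lra.
Qed.

(** Climbing from [Q] to the top, the interval is doubled until it is as long as
    [e] and [e'] are far apart; the first such interval contains both in its window.
    If there is none, the top does. *)
Lemma grid_points_climb m Q e e' : iter m parent Q = t -> T Q ->
  `|e - lft R Q| <= 2 * dlen R Q -> grid Q <= `|e - e'| ->
  `|e' - lft R t| <= 2 * dlen R t ->
  exists P, [/\ T P, `|e - lft R P| <= 3 * dlen R P,
    `|e' - lft R P| <= 3 * dlen R P & grid P <= `|e - e'|].
Proof.
elim: m Q => [|m IH] Q.
  move=> /= <- TQ h1 h2 h3; exists Q; split=> //; have := dlen_gt0 R Q; lra.
rewrite iterSr => Qt TQ h1 h2 h3; have l0 := dlen_gt0 R Q.
have [le|lt] := leP `|e - e'| (dlen R Q).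
  exists Q; split=> //; first lra.
  by move: h1 le; rewrite !ler_norml; lra.
apply: (IH (parent Q)) => //.
- apply: Tup TQ (@dsub_parent R Q) _; rewrite -Qt; exact: dsub_ancestor.
- rewrite dlen_parent; have [b E] := parentK Q.
  have : lft R Q = lft R (parent Q) \/ lft R Q = lft R (parent Q) + dlen R Q.
    rewrite -{1 3}E; case: b {E}; [right|left]; last exact: lft_lchild.
    by rewrite [LHS]lft_rchild dlen_parent; congr (_ + _); field.
  by move: h1; rewrite !ler_norml => h1 [E'|E']; move: h1; rewrite E'; lra.
- rewrite dlen_parent ler_pdivrMr ?exprn_gt0//.
  have : 2 <= 2 ^+ K :> R.
    by case: K K0 => // K' _; rewrite exprS ler_peMr// exprn_ege1// ler1n.
  move=> h; have : `|e - e'| * 2 <= `|e - e'| * 2 ^+ K by rewrite ler_wpM2l.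
  lra.
Qed.

(** Both points are multiples of the finer mesh. *)
Lemma grid_points_sep Q Q' (i i' : int) : dlen R Q <= dlen R Q' ->
  i%:~R * grid Q != i'%:~R * grid Q' ->
  grid Q <= `|i%:~R * grid Q - i'%:~R * grid Q'|.
Proof.
move=> QQ'; have [l ->] : exists l : nat, grid Q' = grid Q * 2 ^+ l.
  have jj : Q'.1 <= Q.1 by move: QQ'; rewrite /dlen ler_eXz2l ?ltr1n// lerN2.
  exists `|Q.1 - Q'.1|%N; rewrite mulrAC; congr (_ / _).
  rewrite /dlen exprnP -expfzDr ?pnatr_eq0// gez0_abs ?subr_ge0//.
  by congr (_ ^ _); ring.
rewrite (_ : _ - _ = (i - i' * 2 ^+ l)%:~R * grid Q); last first.
  by rewrite intrB intrM rmorphXn /=; ring.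
move=> ne; rewrite normrM (gtr0_norm (grid_gt0 Q)) ler_peMl ?(ltW (grid_gt0 Q))//.
rewrite -intr_norm ler1z -gtz0_ge1 normr_gt0 subr_eq0.
apply: contra_neq ne => ->; rewrite intrM rmorphXn /=; ring.
Qed.

Lemma grid_points_scale e e' : grid_points e -> grid_points e' -> e != e' ->
  exists P, [/\ T P, `|e - lft R P| <= 3 * dlen R P,
    `|e' - lft R P| <= 3 * dlen R P & grid P <= `|e - e'|].
Proof.
move=> he he' ne; have te := grid_points_top he; have te' := grid_points_top he'.
move: he he' => [Q [TQ [[i ei] h]]] [Q' [TQ' [[i' ei'] h']]].
have [m Qm] := dsub_iter (Tsub TQ); have [m' Qm'] := dsub_iter (Tsub TQ').
have [le|/ltW le] := leP (dlen R Q) (dlen R Q').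
  by apply: grid_points_climb Qm TQ h _ te'; rewrite ei ei' grid_points_sep// -ei -ei'.
have [|P [? ? ? ?]] := grid_points_climb Qm' TQ' h' _ te.
  by rewrite ei ei' grid_points_sep// -ei -ei' eq_sym.
by exists P; split=> //; rewrite distrC.
Qed.

Lemma grid_closure_prec s s' : grid_closure s -> grid_closure s' -> s' <= s ->
  prec u k (Phi s') (Phi s).
Proof.
move=> hs hs'; rewrite le_eqVlt => /orP[/eqP ->|lt]; first exact: prec_refl.
have r0 : 0 < (s - s') / 10 by lra.
have [e he] := hs _ r0; have [e' he'] := hs' _ r0; rewrite !ler_norml => h' h.
have [|P [TP]] := grid_points_scale he he'; first by apply/eqP => E; lra.
have ep : 0 <= e - e' by lra.
rewrite (ger0_norm ep) !ler_norml => h1 h2 h3; apply: (Tcone TP); rewrite ?ler_norml; lra.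
Qed.

Lemma grid_closure_closed : limit_closed grid_closure.
Proof.
move=> s h r r0; have r2 : 0 < r / 2 by lra.
have [e he se] := h _ r2; have [e' he' ee] := he _ r2; exists e' => //.
by move: se ee; rewrite !ler_norml; lra.
Qed.

Lemma grid_closure_top : grid_closure (lft R t).
Proof.
apply: grid_points_closure; exists t; split=> //; split.
  exists (t.2 * 2 ^+ K); rewrite intrM rmorphXn /= /lft.
  by field; rewrite expf_neq0// pnatr_eq0.
by rewrite subrr normr0 mulr_ge0// ltW// dlen_gt0.
Qed.

Lemma grid_closure_bounded s : grid_closure s -> `|s - lft R t| <= 3 * dlen R t.
Proof.
move=> /(_ _ (dlen_gt0 R t))[e /grid_points_top]; rewrite !ler_norml; lra.
Qed.

End TreeCurve.

Section CurveThroughTree.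
Variables (R : realType) (n : nat) (Phi : R -> heis R n).
Hypothesis base_lip : forall s s', enorm (base Phi s - base Phi s') <= 2 * `|s - s'|.
Variables (E : set R) (u : 'rV[R]_(n + n)) (k M a : R).
Hypotheses (u1 : enorm u = 1) (k01 : 0 <= k <= 9^-1).
Hypotheses (Ea : E a) (Eclosed : limit_closed E).
Hypothesis Ebounded : forall s, E s -> `|s - a| <= M.
Hypothesis Eprec : forall s s', E s -> E s' -> s' <= s -> prec u k (Phi s') (Phi s).

Local Notation coord s := (dot (Phi s).1 u).

Lemma coord_lip s s' : `|coord s - coord s'| <= 2 * `|s - s'|.
Proof.
rewrite -dotNl -dotDl (le_trans (dot_abs _ _))// u1 mulr1.
exact: base_lip.
Qed.

Lemma coord_closed_le r : limit_closed [set s | E s /\ coord s <= r].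
Proof.
move=> s h; split.
  by apply: Eclosed => e /h[x [Ex _] sx]; exists x.
apply/ler_addgt0Pr => e e0; have e2 : 0 < e / 2 by lra.
have [x [Ex xr] sx] := h _ e2; have := coord_lip s x.
by move=> /le_trans/(_ (ler_wpM2l _ sx)); rewrite ler0n ler_norml => /(_ isT); lra.
Qed.

Lemma coord_closed_ge r : limit_closed [set s | E s /\ r <= coord s].
Proof.
move=> s h; split.
  by apply: Eclosed => e /h[x [Ex _] sx]; exists x.
apply/ler_addgt0Pr => e e0; have e2 : 0 < e / 2 by lra.
have [x [Ex xr] sx] := h _ e2; have := coord_lip s x.
by move=> /le_trans/(_ (ler_wpM2l _ sx)); rewrite ler0n ler_norml => /(_ isT); lra.
Qed.

Lemma coord_mono s s' : E s -> E s' -> s' <= s -> coord s' <= coord s.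
Proof. by move=> Es Es' ss; exact: prec_le (Eprec Es Es' ss). Qed.

(** The image of [E] is a chain, and closedness of [E] with continuity of the
    [u]-coordinate gives every gap its endpoints. *)
Lemma exists_lipschitz_graph_through L : 0 < L -> 9 * k <= L ->
  3 / 2 * (9 * k) <= L ^+ 2 ->
  exists2 A, intrinsic_lipschitz_graph L u A & forall s, E s -> A (Phi s).
Proof.
move=> L0 kL kL2.
have up s : E s -> s <= a + M by move=> /Ebounded; rewrite ler_norml; lra.
have lo s : E s -> a - M <= s by move=> /Ebounded; rewrite ler_norml; lra.
have [s0 E0 m0] := limit_closed_min Eclosed Ea lo.
have [s1 E1 m1] := limit_closed_max Eclosed Ea up.
have ch : chain_between u k (Phi @` E) (Phi s0) (Phi s1).
  split; [|by exists s0|by exists s1|].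
    move=> _ _ [s Es <-] [s' Es' <-]; have [h|/ltW h] := leP s s'.
      by left; exact: Eprec.
    by right; exact: Eprec.
  move=> r /andP[r0 r1].
  have [b [Eb br] bm] := @limit_closed_max _ _ s0 (a + M) (@coord_closed_le r)
    (conj E0 r0) (fun x h => up x h.1).
  have [c [Ec cr] cm] := @limit_closed_min _ _ s1 (a - M) (@coord_closed_ge r)
    (conj E1 r1) (fun x h => lo x h.1).
  exists (Phi b), (Phi c); split; [by exists b|by exists c|by rewrite br cr|].
  move=> _ [s Es <-]; have [h|/ltW h] := leP (coord s) r; [left|right].
    by apply: coord_mono => //; exact: bm.
  by apply: coord_mono => //; exact: cm.
have [g [gc gP]] := exists_curve_through_chain u1 k01 ch.
have k9 : 0 <= 9 * k <= 1 by have := k01; lra.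
have [h hc hg] := curve_on_extend u1 k9 (coord_mono E1 E0 (m0 _ E1)) gc.
exists (range h); first by apply: (curve_intrinsic_lipschitz u1 _ _ _ _ hc) => //; have := k01; lra.
move=> s Es; exists (coord s) => //.
have cs : coord s0 <= coord s <= coord s1.
  by rewrite !coord_mono//; [exact: m1|exact: m0].
by rewrite hg// gP//; exists s.
Qed.

End CurveThroughTree.

(** * The corona decomposition *)

Section Main.
Variables (R : realType) (n : nat).

Lemma exists_pow2 (x : R) : exists m : nat, x <= 2 ^+ m.
Proof.
exists (Num.truncn x).+1; have [x0|/ltW x0] := leP 0 x; last first.
  by rewrite (le_trans x0)// exprn_ge0.
have /andP[_ /ltW h] := truncn_itv x0; apply: le_trans h _.
by rewrite -natrX ler_nat ltnW// ltn_expl.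
Qed.

Section Graph.
Variables (v : 'rV[R]_(n + n)) (phi : heis R n -> heis R n).
Hypotheses (v1 : enorm v = 1) (phi_lip : intrinsic_lipschitz 1 v phi).

Local Notation Phi := (fun s => graph_map phi (hline v s)).

Lemma base_dot s s' : dot (base Phi s - base Phi s') v = s - s'.
Proof.
have vv := enorm1_dot v1.
have h r : dot (phi (hline v r)).1 v = 0 by apply: phi_lip.1; exists r.
by rewrite /base /graph_map /= !dotE !h vv; ring.
Qed.

Lemma graph_increment s s' :
  enorm ((base Phi s - base Phi s') - (s - s') *: v) <= `|s - s'| /\
  `|(incr Phi s' s).2 - 2^-1 * ((s - s') * symp v (base Phi s - base Phi s'))| <=
     (s - s') ^+ 2.
Proof.
have := phi_lip.2 (hline v s) (hline v s').
move=> /(_ (ex_intro2 _ _ s I erefl) (ex_intro2 _ _ s' I erefl)) /=.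
rewrite -/(incr Phi s' s) mul1r.
have ip : dot (incr Phi s' s).1 v = s - s' by rewrite incr1 base_dot.
rewrite /hprojW /hprojV ip.
have -> : hnorm (hline v (s - s')) = `|s - s'|.
  rewrite /hnorm /hline /= enormZ v1 mulr1 normr0 sqrtr0.
  exact: max_l.
rewrite /hnorm ge_max hmul_base hmul_vert incr1.
rewrite [(hinv _).1]/= [(hinv _).2]/= => /andP[h1 h2]; split.
  by rewrite addrC.
move: h2; rewrite oppr0 add0r sympNl sympZl => h2.
rewrite -mulrN -[leRHS]real_normK ?num_real//.
rewrite -[leLHS]sqr_sqrtr// ler_sqr ?nnegrE ?sqrtr_ge0//.
Qed.

Lemma graph_base_lip s s' : enorm (base Phi s - base Phi s') <= 2 * `|s - s'|.
Proof.
have [h _] := graph_increment s s'.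
rewrite -[X in enorm X](subrK ((s - s') *: v)) (le_trans (enormD _ _))//.
by rewrite enormZ v1; lra.
Qed.

Lemma graph_vert_lip s s' : `|(incr Phi s' s).2| <= 2 * (s - s') ^+ 2.
Proof.
have [_ h] := graph_increment s s'.
have h' : `|(s - s') * symp v (base Phi s - base Phi s')| <= 2 * (s - s') ^+ 2.
  rewrite normrM -real_normK ?num_real// expr2 mulrCA ler_wpM2l//.
  rewrite (le_trans (symp_le _ _))// v1 mul1r; exact: graph_base_lip.
move: h h'; rewrite !ler_norml; lra.
Qed.

Lemma graph_slope_ge1 Q : 1 <= enorm (slope (base Phi) Q).
Proof.
have l0 := dlen_gt0 R Q.
have -> : 1 = dot (slope (base Phi) Q) v.
  rewrite /slope dotZl base_dot addrAC subrr add0r mulVf// gt_eqF//.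
by rewrite (le_trans (dot_cs _ _))// v1 mulr1.
Qed.

Lemma hdist_incr s e : hdist (Phi s) (Phi e) <= 2 * `|s - e|.
Proof.
rewrite /hdist -/(incr Phi e s) /hnorm ge_max incr1 graph_base_lip/=.
rewrite -ler_sqr ?nnegrE ?sqrtr_ge0 ?mulr_ge0// sqr_sqrtr// exprMn.
rewrite real_normK ?num_real// (le_trans (graph_vert_lip _ _))//.
by rewrite ler_wpM2r ?sqr_ge0// expr2; lra.
Qed.

End Graph.

Lemma hdist_set_le (p q : heis R n) (A : set (heis R n)) r :
  A q -> hdist p q <= r -> hdist_set p A <= r.
Proof.
move=> Aq pq; apply: le_trans pq; apply: ge_inf; last by exists q.
by exists 0 => _ [x _ <-]; rewrite /hdist /hnorm le_max enorm_ge0.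
Qed.

End Main.

Theorem theorem1p3 (R : realType) (n : nat) (eta : R) (heta : 0 < eta < 1) :
  exists2 C : R, 1 <= C &
    forall (v : 'rV[R]_(n + n)) (phi : heis R n -> heis R n),
      enorm v = 1 -> intrinsic_lipschitz 1 v phi ->
      exists (G B : set dyadic) (F : set (set dyadic)),
        coronization C G B F /\
        forall T : set dyadic, F T ->
          exists (vT : 'rV[R]_(n + n)) (GammaT : set (heis R n)),
            [/\ enorm vT = 1,
                intrinsic_lipschitz_graph eta vT GammaT
              & forall (Q : dyadic) (s : R), T Q -> ddouble Q s ->
                  hdist_set (graph_map phi (hline v s)) GammaT
                  <= eta * dlen R Q].
Proof.
case/andP: heta => eta0 eta1.
(* [9 * k] is the opening of the cone for the approximating graphs; the bound
   [3 / 2 * (9 * k) <= eta ^+ 2] dictates 14 *)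
pose k := eta ^+ 2 / 14.
have eta2 : 0 < eta ^+ 2 by rewrite exprn_gt0.
have eta3 : eta ^+ 2 <= eta by rewrite expr2 ler_piMl// ltW.
have k0 : 0 < k by rewrite /k; lra.
have k1 : k <= 14^-1 by rewrite /k; lra.
have [N' hN] := exists_pow2 (16 / k); pose N := (2 ^ N')%N.
have NE : N%:R = 2 ^+ N' :> R by rewrite /N natrX.
have N0 : (0 < N)%N by rewrite expn_gt0.
have N0R : 0 < N%:R :> R by rewrite ltr0n.
have Nk : 16 <= k * N%:R by rewrite NE mulrC -ler_pdivrMr.
clearbody N.
(* [b] bounds both the drift of the slopes in a tree and the relative error at the
   finest distance [dlen R Q / (2 * 2 ^+ K)] used for [Q] *)
pose b := k / (24 * N%:R).
have b0 : 0 < b by rewrite divr_gt0// mulr_gt0.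
have bk : 24 * N%:R * b <= k by rewrite /b mulrC divfK// gt_eqF// mulr_gt0.
have [K' hK'] := exists_pow2 (2 / eta); pose K := K'.+1.
have K0 : (0 < K)%N by [].
have hK : 2 / 2 ^+ K <= eta.
  rewrite ler_pdivrMr ?exprn_gt0// mulrC -ler_pdivrMr// (le_trans hK')//.
  by rewrite /K exprS ler_peMl ?exprn_ge0// ler1n.
have K2 : 2 <= 2 ^+ K :> R by rewrite exprS ler_peMr// exprn_ege1// ler1n.
clearbody K.
have K2p : 0 < 2 ^+ K :> R by rewrite exprn_gt0.
have [m hm] := exists_pow2 (90 * (2 * 2 ^+ K) / b).
pose e : R := 90 / 2 ^+ m.
have eb : e * (2 * 2 ^+ K) <= b.
  move: hm; rewrite ler_pdivrMr// => hm.
  by rewrite /e mulrAC ler_pdivrMr ?exprn_gt0// [leRHS]mulrC.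
pose CT : R := 1 + (2 * (nonflat_bound R m + 2) + 40 / b ^+ 2).
have nf0 : 0 <= nonflat_bound R m.
  by rewrite /nonflat_bound !mulr_ge0 ?exprn_ge0// sumr_ge0// => q _; rewrite mulr_ge0 ?exprn_ge0.
have db0 : 0 <= 40 / b ^+ 2 by rewrite divr_ge0// sqr_ge0.
exists CT; first by rewrite /CT; lra.
move=> v phi v1 hphi; set Phi := fun s => graph_map phi (hline v s).
have lip : forall s s', enorm (base Phi s - base Phi s') <= 2 * `|s - s'|.
  exact: graph_base_lip.
have vert : forall s s', `|(incr Phi s' s).2| <= 2 * (s - s') ^+ 2.
  exact: graph_vert_lip.
pose gd := good (base Phi) m; pose kp := keep (base Phi) m b.
have off0 : forall Q, gd Q -> Q.2 != 0 /\ Q.2 != -1 by exact: good_off0.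
have kgd : forall t P b, kp t P -> gd (child b P) by exact: keep_good.
exists [set Q | gd Q], [set Q | ~ gd Q], (forest gd kp); split.
  split.
  - split; first by rewrite setUv.
    by rewrite classical_sets.setICr.
  - apply: carleson_packing_of; apply: carleson_mono (carleson_bad m lip).
    by rewrite /CT; lra.
  - exact: forest_is_forest.
  - by apply: forest_packing => //; exact: carleson_tops.
move=> _ [t ht <-].
have [gt _] := ht.
pose u := (enorm (slope (base Phi) t))^-1 *: slope (base Phi) t.
have s1 : 1 <= enorm (slope (base Phi) t) by exact: graph_slope_ge1.
have u1 : enorm u = 1.
  rewrite enormZ ger0_norm ?invr_ge0 ?enorm_ge0// mulVf// gt_eqF//.
  exact: lt_le_trans ltr01 s1.
pose T := tree_of gd kp t.
have Tt : T t by [].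
have Tsub Q : T Q -> dsub R Q t by move=> [_ <-]; exact: dsub_top_of.
have Tup Q P : T Q -> dsub R Q P -> dsub R P t -> T P.
  have [_ up _] := tree_of_is_tree R off0 kgd ht.
  by move=> TQ QP Pt; apply: up TQ QP _; rewrite (tree_of_top R off0).
have Tcone Q s s' : T Q ->
    `|s - lft R Q| <= 4 * dlen R Q -> `|s' - lft R Q| <= 4 * dlen R Q ->
    s' <= s -> dlen R Q / 2 ^+ K <= 2 * (s - s') -> prec u k (Phi s') (Phi s).
  move=> [gQ rQ] hs hs' ss hl.
  have [fQ _ _] := gQ.
  have sQ : enorm (slope (base Phi) Q - slope (base Phi) t) <= b.
    by rewrite -rQ; exact: slope_near_top.
  apply: (cone_of_flat lip vert _ N0 Nk (ltW b0) bk fQ sQ s1 hs hs' ss).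
    by rewrite k0; lra.
  have l0 := dlen_gt0 R Q.
  move: hl; rewrite ler_pdivrMr// => hl.
  have e0 : 0 <= e by rewrite divr_ge0// exprn_ge0.
  apply: le_trans (ler_wpM2l e0 hl) _.
  have ss0 : 0 <= s - s' by rewrite subr_ge0.
  have := ler_wpM2r ss0 eb; rewrite /e; congr (_ <= _); ring.
have k9 : 0 <= k <= 9^-1 by lra.
pose E : set R := grid_closure T K.
have [A lipA EA] : exists2 A, intrinsic_lipschitz_graph eta u A & forall s, E s -> A (Phi s).
  apply: (exists_lipschitz_graph_through lip u1 k9
    (@grid_closure_top R T t K Tt) (@grid_closure_closed R T K)
    (@grid_closure_bounded R T t K Tsub)) => //.
  - move=> s s' Es Es' ss; apply: (grid_closure_prec Tsub Tup K0 Tcone) => //.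
  - by rewrite /k; lra.
  - by rewrite /k; lra.
exists u, A; split=> // Q s TQ sQ.
have l0 := dlen_gt0 R Q; have g0 : 0 < dlen R Q / 2 ^+ K by rewrite divr_gt0.
have gl : dlen R Q / 2 ^+ K <= dlen R Q / 2 by rewrite ler_pM2l// lef_pV2 ?posrE.
(* the grid point just below [s] *)
pose i := Num.floor (s / (dlen R Q / 2 ^+ K)).
pose x : R := i%:~R * (dlen R Q / 2 ^+ K).
have sx : `|s - x| <= dlen R Q / 2 ^+ K.
  have /andP[] := floor_itv (s / (dlen R Q / 2 ^+ K)); rewrite -/i intrD.
  rewrite ler_pdivlMr// ltr_pdivrMr// -/x mulrDl -/x mul1r ler_norml; lra.
have xE : grid_points T K x.
  exists Q; split=> //; split; first by exists i.
  move: sQ sx; rewrite /ddouble /= in_itv /= /dmid mulrDl -/(lft R Q).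
  rewrite !ler_norml; lra.
apply: (hdist_set_le (EA x (grid_points_closure xE))).
apply: le_trans (hdist_incr v1 hphi s x) _.
apply: le_trans (_ : 2 * (dlen R Q / 2 ^+ K) <= _); first by rewrite ler_pM2l.
by rewrite mulrCA mulrC ler_pM2r// mulrC.
Qed.
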